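(* Let $P$ be an indecomposable rational function with complex coefficients. Suppose that $P$ has at least one simple critical value. Then the curve $h_P(x,y)=0$ is irreducible.
   Context: A non-constant rational function $F$ is regarded as a holomorphic map $\mathbb{CP}^1\to\mathbb{CP}^1$ of degree $\deg F$. A point $s\in\mathbb{CP}^1$ is called a critical value of $F$ if $F^{-1}\{s\}$ contains fewer than $\deg F$ points, and a simple critical value if $F^{-1}\{s\}$ contains exactly $\deg F-1$ points. A rational function $P$ is called decomposable if there exist rational functions $A,B$ with $\deg A>1$, $\deg B>1$ such that $P=A\circ B$; otherwise $P$ is called indecomposable. Write $P=P_1/P_2$ with $P_1,P_2$ polynomials without common roots. The curve $h_P(x,y)=0$ is the affine algebraic curve $$h_P(x,y):\ \frac{P_1(x)P_2(y)-P_2(x)P_1(y)}{x-y}=0,$$ and it is called irreducible if the polynomial on the left-hand side is irreducible in $\mathbb C[x,y]$. *)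

(* Defs.v *)
From HB Require Import structures.
From mathcomp Require Import all_boot all_order all_algebra.
From mathcomp Require Import mathcomp_extra boolp classical_sets functions.
From mathcomp Require Import cardinality reals.
From mathcomp Require Import complex.

Set Implicit Arguments.
Unset Strict Implicit.
Unset Printing Implicit Defensive.

Import Order.TTheory GRing.Theory Num.Theory.

Local Open Scope ring_scope.

Notation "x %:F" := (@FracField.tofrac _ x) : ring_scope.

Section RationalFunctions.
Variable K : fieldType.

Implicit Types (F A B : {fraction {poly K}}) (p q : {poly K}).

(* F = rnum F / rden F in lowest terms (see rnum_rden, coprime_rnum_rden).    *)
Definition rnum F : {poly K} :=
  \n_(repr F) %/ gcdp \n_(repr F) \d_(repr F).

Definition rden F : {poly K} :=
  \d_(repr F) %/ gcdp \n_(repr F) \d_(repr F).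

(* max of the degrees of rnum F and rden F: the degree of F as a map          *)
(* CP^1 -> CP^1 when F is not constant, and 0 when it is.                     *)
Definition rdeg F : nat := (maxn (size (rnum F)) (size (rden F))).-1.

(* K^1 \cup {oo}, with None as the point at infinity.                         *)
Definition proj_line : Type := option K.

(* At infinity F takes the value oo if deg (rnum F) > deg (rden F), and the   *)
(* ratio of the coefficients of degree deg (rden F) otherwise.                *)
Definition rmap F (z : proj_line) : proj_line :=
  match z with
  | Some a =>
      if (rden F).[a] == 0 then None else Some ((rnum F).[a] / (rden F).[a])
  | None =>
      if (size (rden F) < size (rnum F))%N then None
      else Some ((rnum F)`_(size (rden F)).-1 / lead_coef (rden F))
  end.

(* The number of preimages is required to be n with n + 1 = rdeg F, rather    *)
(* than (rdeg F).-1, so that a constant F has no simple critical value.       *)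
Definition simple_critical_value F (s : proj_line) : Prop :=
  exists2 n : nat, n.+1 = rdeg F &
    (rmap F @^-1` [set s] #= `I_n)%classic%card.

(* p.[B], the polynomial p evaluated at an element B of the field K(x).       *)
Definition eval_at p B : {fraction {poly K}} :=
  (map_poly (fun c : K => c%:P%:F) p).[B].

(* The denominator is nonzero as soon as B is not constant.                   *)
Definition rcomp A B : {fraction {poly K}} :=
  eval_at (rnum A) B / eval_at (rden A) B.

Definition decomposable F : Prop :=
  exists A B, [/\ (1 < rdeg A)%N, (1 < rdeg B)%N & F = rcomp A B].

Definition indecomposable F : Prop := ~ decomposable F.

(* Bivariate polynomials are in {poly {poly K}} = K[x][y]: the variable x is  *)
(* 'X%:P and y is 'X, so p(x) is p%:P and p(y) is map_poly polyC p = p^:P.    *)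
(* The division by x - y is exact: see hpolyE.                                *)
Definition hpoly p q : {poly {poly K}} :=
  (p%:P * q^:P - q%:P * p^:P) %/ ('X%:P - 'X).

End RationalFunctions.

(* Irreducibility in the ring R. The library's irreducible_poly, used on      *)
(* {poly {poly K}}, would be irreducibility over the fraction field K(x).     *)
Definition irreducible_elt (R : idomainType) (h : R) : Prop :=
  [/\ h != 0, h \isn't a GRing.unit &
      forall f g : R, h = f * g -> f \is a GRing.unit \/ g \is a GRing.unit].

Section Facts.
Variable K : fieldType.
Implicit Types (F : {fraction {poly K}}) (p q : {poly K}).

Lemma rden_neq0 F : rden F != 0.
Proof.
by rewrite /rden dvdp_div_eq0 ?dvdp_gcdr // denom_ratioP.
Qed.

Lemma coprime_rnum_rden F : coprimep (rnum F) (rden F).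
Proof.
by apply: coprimep_div_gcd; rewrite denom_ratioP orbT.
Qed.

Lemma frac_repr F : F = (\n_(repr F))%:F / (\d_(repr F))%:F.
Proof.
have d0 : (\d_(repr F))%:F != 0 :> {fraction {poly K}}.
  by rewrite tofrac_eq0 denom_ratioP.
apply: (canRL (mulfK d0)).
rewrite -{1}[F]reprK; set r := repr F.
rewrite [RHS](_ : _ = \pi_(FracField.type _)%qT (Ratio (\n_ r) 1)); last first.
  by unlock FracField.tofrac.
rewrite [X in _ * X](_ : _ = \pi_(FracField.type _)%qT (Ratio (\d_ r) 1)); last first.
  by unlock FracField.tofrac.
rewrite -[LHS]FracField.pi_mul; apply/eqmodP => /=.
rewrite FracField.equivfE /FracField.mulf.
by rewrite !numden_Ratio ?mulf_neq0 ?oner_neq0 ?denom_ratioP //= !mulr1 mulrC.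
Qed.

Lemma rnum_rden F : F = (rnum F)%:F / (rden F)%:F.
Proof.
rewrite {1}(frac_repr F).
set n := \n_(repr F); set d := \d_(repr F).
have d0 : d != 0 by exact: denom_ratioP.
have g0 : gcdp n d != 0 by rewrite gcdp_eq0 negb_and d0 orbT.
have g0F : (gcdp n d)%:F != 0 :> {fraction {poly K}} by rewrite tofrac_eq0.
have -> : n%:F = (rnum F)%:F * (gcdp n d)%:F :> {fraction {poly K}}.
  by rewrite -tofracM divpK ?dvdp_gcdl.
have -> : d%:F = (rden F)%:F * (gcdp n d)%:F :> {fraction {poly K}}.
  by rewrite -tofracM divpK ?dvdp_gcdr.
by rewrite -mulf_div divff // mulr1.
Qed.

Lemma rnum_rden_uniq p q : q != 0 -> coprimep p q ->
  exists2 c, c != 0 & rnum (p%:F / q%:F) = c *: p /\ rden (p%:F / q%:F) = c *: q.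
Proof.
move=> q0 copq; set F := _ / _.
have d0 := rden_neq0 F; have cop := coprime_rnum_rden F.
have E : p * rden F = rnum F * q.
  apply/eqP; rewrite -tofrac_eq !tofracM.
  by rewrite -eqr_div ?tofrac_eq0 // -rnum_rden.
have eqd : rden F %= q.
  apply/andP; split.
    have cop' : coprimep (rden F) (rnum F) by rewrite coprimep_sym.
    by rewrite -(Gauss_dvdpr _ cop') -E dvdp_mull.
  have copq' : coprimep q p by rewrite coprimep_sym.
  by rewrite -(Gauss_dvdpr _ copq') E dvdp_mull.
have [c c0 Ed] : exists2 c, c != 0 & rden F = c *: q.
  have /eqpP[[a b] /= /andP[a0 b0] Eab] := eqd.
  exists (b / a); first by rewrite mulf_neq0 ?invr_eq0.
  by rewrite mulrC -scalerA -Eab scalerA mulVf // scale1r.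
exists c => //; split=> //; apply: (mulIf q0).
by rewrite -E Ed -scalerAl -scalerAr.
Qed.

Lemma rdegE p q : q != 0 -> coprimep p q ->
  rdeg (p%:F / q%:F) = (maxn (size p) (size q)).-1.
Proof.
by move=> q0 /(rnum_rden_uniq q0)[c c0 [En Ed]]; rewrite /rdeg En Ed !size_scale.
Qed.

Lemma hpolyE p q :
  hpoly p q * ('X%:P - 'X) = p%:P * q^:P - q%:P * p^:P.
Proof.
set N := _ - _ * _.
have lcu : lead_coef ('X%:P - 'X : {poly {poly K}}) \is a GRing.unit.
  by rewrite -opprB lead_coefN lead_coefXsubC unitrN1.
have hr : root N 'X.
  have PX r : r^:P.['X] = r by exact: comp_polyXr.
  rewrite /root /N hornerD hornerN !hornerM !hornerC !PX.
  by rewrite [q * p]mulrC subrr.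
rewrite /hpoly -/N Pdiv.IdomainUnit.divpK //.
by rewrite -opprB dvdpNl dvdp_XsubCl.
Qed.

End Facts.

(* Main.v *)
(* In monodromy terms: the monodromy group is primitive because P is          *)
(* indecomposable, and a simple critical value makes it contain a             *)
(* transposition, so it is the full symmetric group. Here is an algebraic     *)
(* version of this argument.                                                  *)
(*   Write [p, q] for p(x) q(y) - q(x) p(y). Over the critical value there is *)
(* one double point a; the other preimages are simple, so h(a, y) is          *)
(* separable. Let h = f g with f irreducible and f(a, a) = 0. Over the        *)
(* function field K(xi, eta) of the curve f = 0, the polynomials f(xi, Y) and *)
(* g(eta, Y) are coprime, because they are so after specialization at (a, a). *)
(* As (xi - Y) f(xi, Y) g(xi, Y) and (eta - Y) f(eta, Y) g(eta, Y) are        *)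
(* proportional, f(xi, Y) divides (Y - eta) f(eta, Y), and by degrees         *)
(* Q(x, Y) = (Y - x) f(x, Y) satisfies Q(eta, Y) ~ Q(xi, Y): the union of the *)
(* diagonal and of f = 0 is an equivalence relation. A nonconstant B = b1/b2, *)
(* b1, b2 coefficients of Q in Y, then satisfies [b1, b2] ~ Q, so [b1, b2]    *)
(* divides [P1, P2]; dividing P1(Y) and P2(Y) by b1(Y) - B b2(Y) exhibits P   *)
(* as a rational function of B, and 1 < deg B < deg P if h is reducible.      *)
From HB Require Import structures.
Require Import Defs.
From mathcomp Require Import all_boot all_order all_algebra all_field.
From mathcomp Require Import finmap boolp classical_sets cardinality.
From mathcomp Require Import reals.
From mathcomp Require Import complex.
From mathcomp Require Import zify ring.

Set Implicit Arguments.
Unset Strict Implicit.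
Unset Printing Implicit Defensive.

Import Order.TTheory GRing.Theory Num.Theory.

Local Open Scope ring_scope.

(** * The residue field of a prime element *)

(** Let P = p/q be in lowest terms, and write [cross p q] for p(x) q(y) - q(x) p(y), which is h
    times x - y. A reducible h together with a simple critical value yields a field K(B) strictly
    between K(P) and K(x). Since h(a, y) has only simple roots, exactly one irreducible factor f of
    h passes through the double point (a, a). The other factors miss that point, so specializing
    there shows that f = 0 and the diagonal together form an equivalence relation
    ([residue_pencil]). As in Lüroth's theorem, its classes are the fibres of a quotient B = b1/b2
    of coefficients ([residue_decomposition]). Then [cross b1 b2] divides [cross p q], and division
    with remainder turns this into P = A o B ([cross_decomposable]). The computation requires the
    double fibre to be the zero set of p, at finite distance, with deg q < deg p. Replacing (p, q)
    by a combination of determinant 1 leaves [cross] unchanged ([rmap_pencil]), and an involution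
    exchanging a point c with infinity does the rest ([reducible_cross_decomposition]). Division in
    [{poly {poly K}}] ignores factors in x alone, so divisibility is controlled through polynomials
    without such factors ([primx_gauss], [irreducible_primx_prime]). *)

Section PrimeQuotient.
Local Open Scope quotient_scope.
Variables (R : idomainType) (f : R).
Hypotheses (f_nunit : f \isn't a GRing.unit)
  (f_prime : forall u v, (exists w, u * v = f * w) ->
     (exists w, u = f * w) \/ (exists w, v = f * w)).

(** Divisibility is written with an explicit cofactor: on [{poly {poly K}}], [%|] only means
    divisibility up to a nonzero factor in x. *)
Definition principal_ideal (u : R) : bool := `[< exists w, u = f * w >].

Fact principal_ideal_zmod : zmod_closed principal_ideal.
Proof.
split; first by apply/asboolP; exists 0; rewrite mulr0.
move=> x y /asboolP[u ->] /asboolP[v ->]; apply/asboolP; exists (u - v).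
by rewrite mulrBr.
Qed.

Fact principal_ideal_proper : (1 \notin principal_ideal) /\
  (forall a, {in principal_ideal, forall u, a * u \in principal_ideal}).
Proof.
split.
  apply/asboolP => -[w] /esym fw; case/negP: f_nunit.
  by apply/unitrPr; exists w.
move=> a u /asboolP[w ->]; apply/asboolP; exists (a * w).
by rewrite mulrCA.
Qed.

Fact principal_ideal_prime : prime_idealr_closed principal_ideal.
Proof.
move=> u v /asboolP /f_prime H; apply/orP.
by case: H => H; [left|right]; apply/asboolP.
Qed.


HB.instance Definition _ :=
  GRing.isZmodClosed.Build R principal_ideal principal_ideal_zmod.
HB.instance Definition _ :=
  isProperIdeal.Build R principal_ideal principal_ideal_proper.
HB.instance Definition _ :=
  isPrimeIdealrClosed.Build R principal_ideal principal_ideal_prime.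

Let I : prime_idealr R := principal_ideal.
Let Q := {ideal_quot I}.
HB.instance Definition _ := GRing.ComNzRing.on Q.

(** The fraction field is built over an integral domain with a unit structure; on the quotient,
    units and inverses are chosen classically. *)
Definition quot_unit : pred Q := fun x => `[< exists y, y * x = 1 >].
Definition quot_inv (x : Q) : Q :=
  if pselect (exists y, y * x = 1) is left h then sval (cid h) else x.

Fact quot_mulVx : {in quot_unit, left_inverse 1 quot_inv *%R}.
Proof.
by move=> x /asboolP ux; rewrite /quot_inv; case: pselect => // h; case: cid.
Qed.

Fact quot_unitPl (x y : Q) : y * x = 1 -> quot_unit x.
Proof. by move=> yx; apply/asboolP; exists y. Qed.

Fact quot_invr_out : {in [predC quot_unit], quot_inv =1 id}.
Proof.
move=> x /negP nux; rewrite /quot_inv; case: pselect => // h.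
by case: nux; apply/asboolP.
Qed.

HB.instance Definition _ :=
  GRing.ComNzRing_hasMulInverse.Build Q quot_mulVx quot_unitPl quot_invr_out.
HB.instance Definition _ :=
  GRing.ComUnitRing_isIntegral.Build Q (@Quotient.rquot_IdomainAxiom R I).

Lemma prime_residue_field : exists (M : fieldType) (phi : {rmorphism R -> M}),
  forall u, phi u = 0 <-> exists w, u = f * w.
Proof.
exists {fraction Q}.
exists (@FracField.tofrac Q \o \pi_Q).
move=> u; have -> : (@FracField.tofrac Q (\pi_Q u) = 0) <-> (u \in I).
  split=> [/eqP|uI]; last apply/eqP; rewrite tofrac_eq0.
    by rewrite -(rmorph0 (\pi_Q)) -Quotient.idealrBE subr0.
  by rewrite -(rmorph0 (\pi_Q)) -Quotient.idealrBE subr0.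
by split=> /asboolP.
Qed.
End PrimeQuotient.

(** * Bivariate polynomials without univariate factors *)

Section PrimitiveBivariate.
Variable K : closedFieldType.
Implicit Types (f g u v w : {poly {poly K}}) (c : {poly K}) (z : K).

Definition specx z u : {poly K} := map_poly (horner_eval z) u.

Lemma specxM z u v : specx z (u * v) = specx z u * specx z v.
Proof. exact: rmorphM. Qed.

Lemma specxC z c : specx z c%:P = (c.[z])%:P.
Proof. by rewrite /specx map_polyC. Qed.

Lemma horner2_specx u (y z : K) : u.[y%:P].[z] = (specx z u).[y].
Proof.
by rewrite /specx -[in RHS](hornerC y z) -/(horner_eval z y%:P) horner_map.
Qed.

Lemma specx_eq0 z u : specx z u = 0 -> exists v, u = ('X - z%:P)%:P * v.
Proof.
move=> uz; exists (map_poly (fun c => c %/ ('X - z%:P)) u); apply/polyP => i.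
rewrite coefCM coef_map_id0 ?div0p // mulrC divpK // dvdp_XsubCl.
by have := congr1 (fun q : {poly K} => q`_i) uz; rewrite coef_map coef0 => /eqP.
Qed.

(* Over an algebraically closed field this says that the coefficients of [u], *)
(* which are polynomials in x, have no common factor.                         *)
Definition primx u : Prop := forall z, specx z u != 0.

Lemma primxM u v : primx (u * v) -> primx u /\ primx v.
Proof.
by move=> uv; split=> z; have := uv z; rewrite specxM mulf_eq0 => /norP[].
Qed.

Lemma primx_neq0 u : primx u -> u != 0.
Proof. by move=> /(_ 0); apply: contraNneq => ->; rewrite /specx rmorph0. Qed.

(** Gauss's lemma. At a root z of c, f(z, y) v(z, y) = 0 with f(z, y) nonzero, so x - z divides both
    c and v and cancels; induction on deg c. *)
Lemma primx_gauss f c u v :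
  primx f -> c != 0 -> c%:P * u = f * v -> exists w, u = f * w.
Proof.
move=> f_prim; have [n] := ubnP (size c).
elim: n c v => // n IH c v szc c0 cu.
have [sz1|sz1] := eqVneq (size c) 1%N.
  have [a a0 ca] := size_poly1P _ (introT eqP sz1).
  exists (a^-1%:P%:P * v); rewrite mulrCA -cu ca mulrA -!polyCM mulVf //.
  by rewrite mul1r.
have [z /factor_theorem[d cd]] := closed_rootP _ sz1.
have fv0 : specx z f * specx z v = 0.
  by rewrite -specxM -cu specxM specxC cd hornerM hornerXsubC subrr mulr0 mul0r.
have /specx_eq0[w vw] : specx z v = 0.
  by apply/eqP; move/eqP: fv0; rewrite mulf_eq0 (negPf (f_prim z)).
have d0 : d != 0 by apply: contraNneq c0; rewrite cd => ->; rewrite mul0r.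
apply: (IH d w) => //.
  by move: szc; rewrite cd size_Mmonic ?monicXsubC // size_XsubC addn2.
have Xz0 : ('X - z%:P)%:P != 0 :> {poly {poly K}}.
  by rewrite polyC_eq0 polyXsubC_eq0.
apply: (mulfI Xz0); rewrite [RHS]mulrCA -vw -cu cd polyCM.
by rewrite mulrA [_%:P * _]mulrC.
Qed.

(** Each extracted factor x - z lowers the degree of the leading coefficient. *)
Lemma primx_part u :
  u != 0 -> exists c v, [/\ c != 0, u = c%:P * v & primx v].
Proof.
have [n] := ubnP (size (lead_coef u)); elim: n u => // n IH u szu u0.
have [pu|/existsNP[z /negP]] := pselect (primx u).
  by exists 1, u; rewrite oner_neq0 mul1r.
rewrite negbK => /eqP/specx_eq0[v uv].
have v0 : v != 0 by apply: contraNneq u0; rewrite uv => ->; rewrite mulr0.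
have [|c [w [c0 vw pw]]] := IH v _ v0.
  move: szu; rewrite uv lead_coefM lead_coefC mulrC.
  rewrite size_Mmonic ?monicXsubC ?lead_coef_eq0 //.
  by rewrite size_XsubC addn2.
exists (('X - z%:P) * c), w; split=> //.
  by rewrite mulf_neq0 ?polyXsubC_eq0.
by rewrite uv vw polyCM mulrA.
Qed.

Lemma primx_unit u : primx u -> (size u <= 1)%N -> u \is a GRing.unit.
Proof.
move=> pu /size1_polyC uE; move: pu; rewrite uE => pu.
have sz1 : size u`_0 = 1%N.
  apply/eqP; rewrite -[_ == _]negbK; apply/negP => /closed_rootP[z /rootP rz].
  by have := pu z; rewrite specxC rz polyC0 eqxx.
have c0 : u`_0`_0 != 0.
  have : lead_coef u`_0 != 0 by rewrite lead_coef_eq0 -size_poly_gt0 sz1.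
  by rewrite lead_coefE sz1.
by rewrite poly_unitE size_polyC coefC /= poly_unitE sz1 unitfE c0 -size_poly_gt0 sz1.
Qed.

Lemma primx_nunit u : primx u -> u \isn't a GRing.unit -> (1 < size u)%N.
Proof. by move=> pu; apply: contraR; rewrite -leqNgt; apply: primx_unit. Qed.

(** If f and u are not coprime over K(x), the primitive part d of their gcd divides f in K[x][y]. It
    has positive degree in y, so irreducibility makes f an associate of d, which divides u. *)
Lemma irreducible_primx_prime f u v : primx f -> irreducible_elt f ->
  (exists w, u * v = f * w) -> (exists w, u = f * w) \/ (exists w, v = f * w).
Proof.
move=> pf [f0 fnu firr] [w uvw].
have dvdE (g a : {poly {poly K}}) : primx g -> g %| a -> exists b, a = g * b.
  move=> pg /Pdiv.Idomain.dvdpP[[c b] /= c0]; rewrite -mul_polyC mulrC => E.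
  by apply: (primx_gauss pg c0); rewrite mulrC E mulrC.
have [cop|] := boolP (coprimep f u).
  right; apply: (dvdE _ _ pf) => //; rewrite -(Gauss_dvdpr _ cop) uvw.
  by rewrite dvdp_mulr.
rewrite /coprimep => sz1; left; apply: (dvdE _ _ pf) => //.
have d0 : gcdp f u != 0 by rewrite gcdp_eq0 (negPf f0).
have [c [d [c0 dE pd]]] := primx_part d0.
have df : d %| gcdp f u by rewrite dE dvdp_mull.
have [e fE] := dvdE d f pd (dvdp_trans df (dvdp_gcdl f u)).
have [ud|ue] := firr _ _ fE.
  case/eqP: sz1; rewrite dE mul_polyC size_scale //.
  by move: ud; rewrite poly_unitE => /andP[/eqP].
have fd : f %| d by rewrite -[d](mulrK ue) -fE dvdp_mulr.
exact: dvdp_trans (dvdp_trans fd df) (dvdp_gcdr f u).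
Qed.

(** Induction on the degree in y: nonunit factors of a primitive polynomial have positive degree in
    y, and one of them vanishes at the point. *)
Lemma irreducible_factor_at (x y : K) u : primx u -> u.[x%:P].[y] = 0 ->
  exists f v, [/\ u = f * v, irreducible_elt f & f.[x%:P].[y] = 0].
Proof.
have [n] := ubnP (size u); elim: n u => // n IH u szu pu uxy.
have unu : u \isn't a GRing.unit.
  apply/negP => uu; have /(congr1 (fun t => t.[x%:P].[y]))/eqP := mulrV uu.
  by rewrite !hornerM uxy mul0r !hornerC eq_sym oner_eq0.
have [irr|nirr] := pselect (irreducible_elt u).
  by exists u, 1; rewrite mulr1.
have [v [w [uE vnu wnu]]] :
    exists v w, [/\ u = v * w, v \isn't a GRing.unit & w \isn't a GRing.unit].
  apply: contrapT => H; apply: nirr; split=> // [|v w uE]; first exact: primx_neq0.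
  have [vu|vnu] := boolP (v \is a GRing.unit); first by left.
  by right; apply/negPn/negP => wnu; apply: H; exists v, w.
wlog vxy : v w uE vnu wnu / v.[x%:P].[y] = 0.
  move=> wl; have : v.[x%:P].[y] * w.[x%:P].[y] == 0 by rewrite -!hornerM -uE uxy.
  rewrite mulf_eq0 => /orP[] /eqP; first exact: (wl v w uE vnu wnu).
  by apply: (wl w v _ wnu vnu); rewrite mulrC.
have [pv pw] : primx v /\ primx w by apply: primxM; rewrite -uE.
have v1 := primx_nunit pv vnu; have w1 := primx_nunit pw wnu.
have [|f [g [vE irr fxy]]] := IH v _ pv vxy.
  move: szu; rewrite uE size_mul ?primx_neq0 //.
  move: v1 w1; case: (size v) (size w) => [|[|a]] [|[|b]] //= _ _.
  rewrite !addSn !addnS !ltnS /=; apply: leq_trans.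
  by rewrite ltnS leq_addr.
by exists f, (g * w); rewrite mulrA -vE.
Qed.

End PrimitiveBivariate.

(** * The polynomial p(x) q(y) - q(x) p(y) *)

Section Cross.
Variable K : numClosedFieldType.
Implicit Types (p q : {poly K}) (h : {poly {poly K}}) (z : K).

Lemma coprimep_no_root p q :
  (forall z, ~ (root p z /\ root q z)) -> coprimep p q.
Proof.
move=> nr; rewrite /coprimep; apply: contraT => /closed_rootP[z].
by rewrite root_gcd => /andP/nr.
Qed.

Definition cross p q : {poly {poly K}} := p%:P * q^:P - q%:P * p^:P.

Lemma specx_cross z p q : specx z (cross p q) = p.[z] *: q - q.[z] *: p.
Proof.
have E r : map_poly (horner_eval z) r^:P = r.
  by rewrite -map_poly_comp map_poly_id // => c _; rewrite /= /horner_eval hornerC.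
rewrite /specx /cross rmorphB !rmorphM /= !map_polyC /= !E.
by rewrite -!mul_polyC.
Qed.

Lemma horner2_cross (y z : K) p q :
  (cross p q).[y%:P].[z] = p.[z] * q.[y] - q.[z] * p.[y].
Proof. by rewrite horner2_specx specx_cross !hornerE. Qed.

Lemma swapXY_cross p q : swapXY (cross p q) = - cross p q.
Proof.
rewrite /cross rmorphB !rmorphM /= !swapXY_polyC !swapXY_map_polyC opprB.
by rewrite [q^:P * _]mulrC [p^:P * _]mulrC.
Qed.

(** A factor x - z would make p and q proportional, since coprime polynomials do not both vanish at
    z; being coprime, they would be constant. *)
Lemma primx_cross p q : coprimep p q -> (1 < maxn (size p) (size q))%N ->
  primx (cross p q).
Proof.
move=> cop sz z; rewrite specx_cross subr_eq0; apply/eqP => E.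
wlog qz : p q cop sz E / q.[z] != 0.
  move=> wl; have [qz0|] := eqVneq q.[z] 0; last exact: (wl p q).
  apply: (wl q p); rewrite // 1?coprimep_sym // 1?maxnC //.
  by apply: contraL cop => pz0; apply/negP => /coprimep_root /(_ pz0); rewrite qz0 eqxx.
have pE : p = (p.[z] / q.[z]) *: q.
  by rewrite mulrC -scalerA E scalerA mulVf // scale1r.
have q0 : size (gcdp p q) != 0%N by rewrite (eqP cop).
have qg : q %| gcdp p q by rewrite dvdp_gcd dvdpp andbT pE -mul_polyC dvdp_mull.
have q1 : (size q <= 1)%N by rewrite -(eqP cop) dvdp_leq // -size_poly_eq0.
have : (size p <= size q)%N by rewrite {1}pE size_scale_leq.
by move=> /leq_trans/(_ q1) p1; move: sz; rewrite ltnNge geq_max p1 q1.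
Qed.

Lemma crossN p q : cross q p = - cross p q.
Proof. by rewrite /cross opprB. Qed.

Lemma coef_cross p q i : (cross p q)`_i = q`_i *: p - p`_i *: q.
Proof.
by rewrite /cross coefB !coefCM !coef_map /= -!mul_polyC; congr (_ - _); exact: mulrC.
Qed.

Lemma cross_mul (d p q : {poly K}) :
  cross (p * d) (q * d) = (d%:P * d^:P) * cross p q.
Proof. by rewrite /cross !polyCM !rmorphM /=; ring. Qed.

Lemma map_cross (F : comNzRingType) (phi : {rmorphism {poly K} -> F}) p q :
  map_poly phi (cross p q) =
    phi p *: map_poly (phi \o polyC) q - phi q *: map_poly (phi \o polyC) p.
Proof. by rewrite /cross rmorphB !rmorphM /= !map_polyC -!map_poly_comp !mul_polyC. Qed.

Lemma cross_scale c q : cross (c *: q) q = 0.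
Proof.
rewrite /cross -!mul_polyC polyCM rmorphM /= map_polyC /=.
by rewrite mulrCA mulrA [_%:P * _%:P * _]mulrAC subrr.
Qed.

(** If the coefficient of top degree in y vanished, p and q would be proportional and [cross p q]
    would be 0. *)
Lemma size_cross p q : cross p q != 0 -> size (cross p q) = maxn (size p) (size q).
Proof.
wlog le_pq : p q / (size p <= size q)%N => [wl|].
  move=> c0; have /orP[pq|qp] := leq_total (size p) (size q); first exact: wl.
  by rewrite maxnC -size_polyN -crossN wl // crossN oppr_eq0.
move=> c0; rewrite (maxn_idPr le_pq); apply/eqP; rewrite eqn_leq; apply/andP; split.
  apply/leq_sizeP => i qi; rewrite coef_cross.
  by rewrite !nth_default ?scale0r ?subr0 // (leq_trans le_pq).
have q0 : q != 0.
  by apply: contraNneq c0 => ->; rewrite /cross polyC0 rmorph0 !mulr0 mul0r subr0.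
rewrite (polySpred q0) ltnNge; apply/negP => /leq_sizeP/(_ _ (leqnn _)).
rewrite coef_cross -lead_coefE => /eqP; rewrite subr_eq0 => /eqP E.
case/eqP: c0; have -> : p = ((lead_coef q)^-1 * p`_(size q).-1) *: q.
  by rewrite -scalerA -E scalerA mulVf ?lead_coef_eq0 // scale1r.
exact: cross_scale.
Qed.

Lemma swapXY_cross_quotient h p q :
  h * ('X%:P - 'X) = cross p q -> swapXY h = h.
Proof.
have X0 : 'X%:P - 'X != 0 :> {poly {poly K}} by rewrite -opprB oppr_eq0 polyXsubC_eq0.
move=> hE; apply: (mulIf X0); apply: oppr_inj.
rewrite hE -swapXY_cross -hE rmorphM rmorphB /= swapXY_X swapXY_Y.
by rewrite -mulrN opprB.
Qed.

Lemma specx_cross_quotient h p q t (a : K) : h * ('X%:P - 'X) = cross p q ->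
  p = ('X - a%:P) * t -> specx a h = q.[a] *: t.
Proof.
move=> hE pE; have X0 : 'X - a%:P != 0 :> {poly K} by rewrite polyXsubC_eq0.
have pa : p.[a] = 0 by rewrite pE hornerM hornerXsubC subrr mul0r.
apply: (mulIf X0); apply: oppr_inj; rewrite -mulrN opprB.
have {1}-> : a%:P - 'X = specx a ('X%:P - 'X).
  by rewrite /specx rmorphB /= map_polyC map_polyX /= /horner_eval hornerX.
by rewrite -specxM hE specx_cross pa scale0r sub0r -scalerAl mulrC -pE.
Qed.

(** Differentiating in y at y = x gives the Wronskian of p and q. *)
Lemma diag_cross_quotient h p q :
  h * ('X%:P - 'X) = cross p q -> h.['X] = q * p^`() - p * q^`().
Proof.
move=> /(congr1 (fun u => u^`().['X])) /eqP.
have PX r : r^:P.['X] = r by exact: comp_polyXr.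
rewrite /cross !(derivM, derivB, derivC, derivX) !deriv_map.
rewrite !(hornerD, hornerN, hornerM, hornerC, hornerX) !PX.
by rewrite !(mul0r, add0r, subrr, mulr0, sub0r, mulrN1) eqr_oppLR opprB => /eqP.
Qed.

(** If the Wronskian vanishes, p divides p', hence p' = 0, which characteristic 0 excludes for
    nonconstant p. *)
Lemma diag_cross_quotient_neq0 h p q : coprimep p q -> (1 < size p)%N ->
  h * ('X%:P - 'X) = cross p q -> h.['X] != 0.
Proof.
move=> cop sz hE; rewrite (diag_cross_quotient hE) subr_eq0; apply/eqP => E.
have p0 : p != 0 by rewrite -size_poly_gt0 ltnW.
have : p %| p^`() by rewrite -(Gauss_dvdpr _ cop) E dvdp_mulr.
have [d0 _|d0 /(dvdp_leq d0)] := eqVneq p^`() 0; last first.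
  by rewrite leqNgt lt_size_deriv.
have /eqP := coef_deriv p (size p).-2; rewrite d0 coef0 eq_sym.
rewrite prednK; last by rewrite -subn1 subn_gt0.
rewrite -lead_coefE mulrn_eq0 lead_coef_eq0 (negPf p0) orbF.
by case: (size p) sz => [|[]].
Qed.

End Cross.

(** * A factor through the double point *)

Section FactorThroughDoublePoint.
Variables (K : numClosedFieldType) (p q t : {poly K}) (n : nat) (a : K).
Variables (h f g : {poly {poly K}}).
Hypotheses (cop : coprimep p q) (size_p : size p = n.+1) (size_q : (size q <= n)%N).
Hypotheses (pE : p = ('X - a%:P) * t) (t_sep : separable_poly t).
Hypotheses (hE : h * ('X%:P - 'X) = cross p q) (hfg : h = f * g).
Hypotheses (f_irr : irreducible_elt f) (f_aa : f.[a%:P].[a] = 0).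
Hypothesis (g_nunit : g \isn't a GRing.unit).

Let pa : p.[a] = 0.
Proof. by rewrite pE hornerM hornerXsubC subrr mul0r. Qed.

Let qa : q.[a] != 0.
Proof. by apply: coprimep_root cop _; apply/rootP. Qed.

Let size_p_gt1 : (1 < size p)%N.
Proof.
have p0 : p != 0 by rewrite -size_poly_gt0 size_p.
have [t0 X0] : t != 0 /\ 'X - a%:P != 0.
  by apply/andP; move: p0; rewrite pE mulf_eq0 negb_or andbC.
rewrite pE size_mul // size_XsubC add2n /=.
by rewrite ltnS size_poly_gt0.
Qed.

Let h_prim : primx h.
Proof.
have : primx (h * ('X%:P - 'X)).
  by rewrite hE; apply: primx_cross => //; rewrite leq_max size_p_gt1.
by case/primxM.
Qed.

Let fg_prim : primx f /\ primx g.
Proof. by apply: primxM; rewrite -hfg. Qed.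

Let f_prim := fg_prim.1.
Let g_prim := fg_prim.2.
Let specx_h : specx a h = q.[a] *: t.
Proof. exact: specx_cross_quotient hE pE. Qed.

Let specx_fg_sep : separable_poly (specx a f * specx a g).
Proof.
by rewrite -specxM -hfg specx_h (eqp_separable (eqp_scale _ qa)).
Qed.

Let coprime_specx : coprimep (specx a f) (specx a g).
Proof. by move: specx_fg_sep; rewrite separable_mul => /and3P[]. Qed.

Let g_aa : g.[a%:P].[a] != 0.
Proof.
rewrite horner2_specx; apply: coprimep_root coprime_specx _.
by rewrite /root -horner2_specx f_aa.
Qed.

(** As deg q < deg p = n, the coefficient of y^n in [cross p q] is a nonzero multiple of q(x), and
    q(a) is nonzero. So f and g keep their degree in y at x = a, as specializing a resultant
    requires. *)
Let lead_fg : (lead_coef f).[a] != 0 /\ (lead_coef g).[a] != 0.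
Proof.
apply/andP; rewrite -negb_or -mulf_eq0 -hornerM -lead_coefM -hfg.
have c0 : cross p q != 0.
  by apply/primx_neq0/primx_cross; rewrite ?leq_max ?size_p_gt1.
have szc : size (cross p q) = n.+1.
  by rewrite size_cross // size_p; apply/maxn_idPl; rewrite leqW.
have := congr1 lead_coef hE; rewrite lead_coefM -opprB lead_coefN lead_coefXsubC.
rewrite mulrN1 [RHS]lead_coefE szc /= coef_cross [q`_n]nth_default // scale0r sub0r.
move=> /oppr_inj ->; rewrite hornerZ mulf_neq0 // -[n]/(n.+1.-1) -size_p -lead_coefE.
by rewrite lead_coef_eq0 -size_poly_gt0 size_p.
Qed.

(** * Computations at the generic point (xi, eta) of the curve f = 0 *)

Section ResidueField.
Variables (M : fieldType) (phi : {rmorphism {poly {poly K}} -> M}).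
Hypothesis (phiP : forall u, phi u = 0 <-> exists w, u = f * w).

(** [ex c] is c(xi) and [ey c] is c(eta); thus [map_poly ex u] is u(xi, Y) and [map_poly ey u] is
    u(eta, Y). *)
Let ex : {rmorphism {poly K} -> M} := phi \o polyC.
Let ey : {rmorphism {poly K} -> M} := phi \o map_poly polyC.
Let xi := phi 'X%:P.
Let eta := phi 'X.

Let phi_aa u : phi u = 0 -> u.[a%:P].[a] = 0.
Proof. by move=> /phiP[w ->]; rewrite !hornerM f_aa mul0r. Qed.

Let phi_f : phi f = 0.
Proof. by apply/phiP; exists 1; rewrite mulr1. Qed.

Let phi_h : phi h = 0.
Proof. by rewrite hfg rmorphM phi_f mul0r. Qed.

Let horner_ey u : (map_poly ey u).[xi] = phi (swapXY u).
Proof. by rewrite map_poly_comp horner_map [swapXY]unlock. Qed.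

Let horner_ex_diag u : (map_poly ex u).[xi] = ex u.['X].
Proof. by rewrite map_poly_comp horner_map horner_map. Qed.

Let ex_neq0 c : c.[a] != 0 -> ex c != 0.
Proof. by apply: contraNneq => /phi_aa; rewrite !hornerC => ->. Qed.

Let ey_neq0 c : c.[a] != 0 -> ey c != 0.
Proof.
by apply: contraNneq => /phi_aa; rewrite horner_map hornerC => ->.
Qed.

(** The resultant r(x, y) in Y of f(x, Y) and g(y, Y) is nonzero at (a, a), because f(a, Y) and g(a,
    Y) are coprime. As f vanishes there, f does not divide r, so r(xi, eta) is nonzero. *)
Let coprime_residue : coprimep (map_poly ex f) (map_poly ey g).
Proof.
pose E : {rmorphism {poly {poly K}} -> K} := horner_eval a \o horner_eval a%:P.
pose r := resultant (map_poly polyC f) (map_poly (map_poly polyC) g).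
have lf : lead_coef (map_poly polyC f) = (lead_coef f)%:P.
  by rewrite lead_coef_map_inj //; apply: polyC_inj.
have lg : lead_coef (map_poly (map_poly polyC) g) = (lead_coef g)^:P.
  by rewrite lead_coef_map_inj ?rmorph0 //; apply: map_inj_poly (@polyC_inj K) _.
have Er : E r = resultant (specx a f) (specx a g).
  rewrite /r map_resultant ?lf ?lg; last 2 first.
  - by rewrite /= /horner_eval hornerC; have [] := lead_fg.
  - by rewrite /= /horner_eval horner_map hornerC; have [] := lead_fg.
  rewrite -!map_poly_comp; congr resultant; apply: eq_map_poly => c /=.
    by rewrite /horner_eval hornerC.
  by rewrite /horner_eval horner_map hornerC.
have phir : phi r = resultant (map_poly ex f) (map_poly ey g).
  rewrite /r map_resultant ?lf ?lg; last 2 first.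
  - by apply: ex_neq0; have [] := lead_fg.
  - by apply: ey_neq0; have [] := lead_fg.
  by rewrite -!map_poly_comp.
have r0 : phi r != 0.
  apply/eqP => /phi_aa /eqP; rewrite -[_ == _]/(E r == 0) Er resultant_eq0.
  by rewrite (eqP coprime_specx).
move: r0; rewrite phir resultant_eq0 -leqNgt /coprimep eqn_leq => -> /=.
rewrite size_poly_gt0 gcdp_eq0 negb_and; apply/orP; left.
by rewrite -lead_coef_eq0 lead_coef_map_eq; apply: ex_neq0; have [] := lead_fg.
Qed.

(** The generic point satisfies p(xi) q(eta) = q(xi) p(eta). *)
Let residue_cross :
  ey q *: map_poly ex (cross p q) = ex q *: map_poly ey (cross p q).
Proof.
pose i := ex \o polyC.
have exP r : map_poly ex r^:P = map_poly i r by rewrite -map_poly_comp.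
have eyP r : map_poly ey r^:P = map_poly i r.
  by rewrite -map_poly_comp; apply: eq_map_poly => c /=; rewrite map_polyC.
have /eqP : phi (cross p q) = 0 by rewrite -hE rmorphM phi_h mul0r.
rewrite /cross !rmorphB !rmorphM /= -![phi _%:P]/(ex _) -![phi _^:P]/(ey _).
rewrite subr_eq0 => /eqP pq; rewrite !map_polyC !exP !eyP /= -!mul_polyC.
rewrite -![phi _%:P]/(ex _) -![phi _^:P]/(ey _) !mulrBr !mulrA -!polyCM.
by rewrite [ey q * _]mulrC pq [ey q * _]mulrC.
Qed.

Let size_ex_f : size (map_poly ex f) = size f.
Proof. by apply: size_map_poly_id0; apply: ex_neq0; have [] := lead_fg. Qed.

Let size_ey_f : size (map_poly ey f) = size f.
Proof. by apply: size_map_poly_id0; apply: ey_neq0; have [] := lead_fg. Qed.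

(** h is symmetric, so f divides [swapXY f] or [swapXY g]; the latter would give g(a, a) = 0. *)
Let swap_f_residue : phi (swapXY f) = 0.
Proof.
have /eqP : phi (swapXY h) = 0 by rewrite (swapXY_cross_quotient hE).
rewrite hfg !rmorphM mulf_eq0 => /orP[/eqP //|/eqP/phi_aa].
by rewrite horner2_swapXY => gaa; move: g_aa; rewrite gaa eqxx.
Qed.

Let diag_f : f.['X] != 0.
Proof.
have := diag_cross_quotient_neq0 cop size_p_gt1 hE.
by rewrite hfg hornerM mulf_eq0 => /norP[].
Qed.

Let f_dvd_polyC c : phi c%:P = 0 -> c = 0.
Proof.
move=> /phiP[w cE]; apply/eqP; apply: contraT => c0.
have f1 : (1 < size f)%N by apply: primx_nunit f_prim _; case: f_irr.
have w0 : w != 0.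
  by apply: contraNneq c0 => w0; move: cE; rewrite w0 mulr0 => /polyC_inj ->.
move/(congr1 (size \o polyseq)): cE => /=.
rewrite size_polyC c0 size_mul // ?primx_neq0 //.
move: w0 f1; rewrite -size_poly_gt0.
by case: (size f) (size w) => [|[|x]] [|y] //= _ _; rewrite addnS.
Qed.

(** Transitivity of the relation: (Y - eta) f(eta, Y) and (Y - xi) f(xi, Y) have the same roots, so
    xi and eta have the same class. *)
Lemma residue_pencil : exists e,
  map_poly ey (('X - 'X%:P) * f) = e *: map_poly ex (('X - 'X%:P) * f).
Proof.
have exX : map_poly ex ('X%:P - 'X) = xi%:P - 'X.
  by rewrite rmorphB /= map_polyC map_polyX.
have eyX : map_poly ey ('X%:P - 'X) = eta%:P - 'X.
  by rewrite rmorphB /= map_polyC !map_polyX /= map_polyX.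
have qx0 : ex q != 0 by apply: ex_neq0.
(* By [residue_cross], f(xi, Y) divides (Y - eta) f(eta, Y) g(eta, Y), and it is coprime to the last
   factor. *)
have fdvd : map_poly ex f %| ('X - eta%:P) * map_poly ey f.
  rewrite -(Gauss_dvdpl _ coprime_residue) -mulrA -rmorphM -hfg.
  rewrite -(dvdpZr _ _ qx0) -opprB -eyX mulNr scalerN dvdpNr mulrC -rmorphM hE.
  by rewrite -residue_cross -hE hfg !rmorphM -mulrA dvdpZr ?dvdp_mulr // ey_neq0.
have /dvdpP[m mE] := fdvd.
have f0 : f != 0 by apply: primx_neq0.
have fy0 : map_poly ey f != 0 by rewrite -size_poly_gt0 size_ey_f size_poly_gt0.
have fx0 : map_poly ex f != 0 by rewrite -size_poly_gt0 size_ex_f size_poly_gt0.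
have m0 : m != 0.
  apply: contraNneq fy0 => m0; move/eqP: mE; rewrite m0 mul0r mulf_eq0.
  by rewrite polyXsubC_eq0.
have szm : size m = 2%N.
  have := congr1 (size \o polyseq) mE; rewrite /= !size_mul ?polyXsubC_eq0 //.
  rewrite size_XsubC size_ex_f size_ey_f.
  move=> E; move: f0 E; rewrite -size_poly_gt0; case: (size f) => [//|s] _ E.
  by apply: (@addIn s); move: E; rewrite [in RHS]addnS.
(* Put Y = xi: f(eta, xi) = 0 by symmetry, while f(xi, xi) is nonzero because f does not vanish
   identically on the diagonal. *)
have mxi : root m xi.
  have /eqP := congr1 (horner^~ xi) mE; rewrite !hornerM horner_ey swap_f_residue.
  rewrite mulr0 eq_sym mulf_eq0 horner_ex_diag => /orP[//|/eqP/f_dvd_polyC/eqP].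
  by rewrite (negPf diag_f).
have [m' m'E] := factor_theorem _ _ mxi.
have /size_poly1P[e e0 m'C] : size m' == 1%N.
  move: szm; rewrite m'E size_Mmonic ?monicXsubC ?size_XsubC ?addn2 //.
    by move=> [->].
  by apply: contraNneq m0 => m'0; rewrite m'E m'0 mul0r.
exists e; rewrite -opprB mulNr !rmorphN !rmorphM /= exX eyX scalerN.
congr (- _); rewrite -opprB mulNr mE m'E m'C -mul_polyC.
by rewrite -mulrA -mulrN -mulNr opprB.
Qed.

(** The coefficients of Q at eta are e times those at xi, so their ratios agree at xi and eta. *)
Lemma residue_coef_cross i j : let Q := ('X - 'X%:P) * f in
  exists w, cross Q`_i Q`_j = f * w.
Proof.
move=> Q; apply/phiP; have [e eE] := residue_pencil.
have E l : ey Q`_l = e * ex Q`_l.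
  by have := congr1 (fun u : {poly M} => u`_l) eE; rewrite coefZ !coef_map.
rewrite /cross rmorphB !rmorphM /= -![phi _%:P]/(ex _) -![phi _^:P]/(ey _) !E.
by rewrite mulrCA [X in _ - X]mulrCA [ex Q`_j * _]mulrC subrr.
Qed.

Let swapXY_f_dvd : exists w, swapXY f = f * w.
Proof. exact/phiP/swap_f_residue. Qed.

Let f_size_gt1 : (1 < size f)%N.
Proof. by apply: primx_nunit f_prim _; case: f_irr. Qed.

Let Q : {poly {poly K}} := ('X - 'X%:P) * f.

Let Q_neq0 : Q != 0.
Proof. by rewrite mulf_neq0 ?polyXsubC_eq0 // primx_neq0. Qed.

Let size_Q : size Q = (size f).+1.
Proof. by rewrite /Q mulrC size_Mmonic ?monicXsubC ?primx_neq0 // size_XsubC addn2. Qed.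

Let size_swapXY_f : size (swapXY f) = size f.
Proof.
have f0 : f != 0 by apply: primx_neq0.
have [w fE] := swapXY_f_dvd.
have sf0 : swapXY f != 0 by rewrite swapXY_eq0.
have := congr1 (@swapXY _) fE; rewrite rmorphM swapXYK /= => fE'.
have d1 : f %| swapXY f by rewrite fE dvdp_mulr.
have d2 : swapXY f %| f by rewrite {2}fE' dvdp_mulr.
by apply/eqP; rewrite eqn_leq !dvdp_leq.
Qed.

Let size_swapXY_Q : size (swapXY Q) = (size f).+1.
Proof.
rewrite rmorphM rmorphB /= swapXY_X swapXY_Y -opprB mulNr size_polyN mulrC.
by rewrite size_Mmonic ?monicXsubC ?swapXY_eq0 ?primx_neq0 // size_XsubC addn2 size_swapXY_f.
Qed.

(** Otherwise all coefficients of Q are proportional to its leading one l, so Q = l(x) c(y). As Q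
    vanishes on the diagonal, l c = 0, hence c = 0 and Q = 0. *)
Let cross_coef_neq0 : exists i, cross Q`_i (lead_coef f) != 0.
Proof.
apply: contrapT => H; case/eqP: Q_neq0.
have ci0 i : cross Q`_i (lead_coef f) = 0.
  by apply/eqP; apply: contrapT => /negP c0; apply: H; exists i.
have [la _] := lead_fg.
pose c := (lead_coef f).[a]^-1 *: specx a Q.
have QE : Q = (lead_coef f)%:P * c^:P.
  apply/polyP => i; rewrite coefCM coef_map coefZ coef_map.
  have /(congr1 (specx a)) := ci0 i.
  rewrite specx_cross [specx a 0]rmorph0 => /eqP; rewrite subr_eq0 => /eqP E.
  by rewrite mulrC mul_polyC /= -scalerA E scalerA mulVf // scale1r.
have /eqP : Q.['X] = 0 by rewrite /Q hornerM hornerXsubC subrr mul0r.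
rewrite {1}QE hornerM hornerC [_.['X]]comp_polyXr mulf_eq0 lead_coef_eq0.
rewrite (negPf (primx_neq0 f_prim)) /= => /eqP c0.
by rewrite QE c0 rmorph0 mulr0.
Qed.

(** b1 and b2 are a coefficient of Q and its leading coefficient, divided by their gcd d; d(xi) and
    d(eta) are nonzero since d(a) is. [cross b1 b2] is then divisible by f, and by Y - x because it
    vanishes on the diagonal while f does not. *)
Let cross_coef_reduced : exists b1 b2 : {poly K},
  [/\ (size b1 <= (size f).+1)%N, (size b2 <= (size f).+1)%N, cross b1 b2 != 0
    & exists u, cross b1 b2 = Q * u].
Proof.
have [i ci0] := cross_coef_neq0.
have [la _] := lead_fg.
set l := lead_coef f in la ci0; pose d := gcdp Q`_i l.
have lE : l = Q`_(size f).
  rewrite -[size f]/((size f).+1.-1) -size_Q -lead_coefE lead_coefM.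
  by rewrite lead_coefXsubC mul1r.
have size_coef_Q j : (size (Q`_j)%R <= (size f).+1)%N.
  by rewrite -size_swapXY_Q -sizeYE max_size_coefXY.
have ciE : cross Q`_i l = (d%:P * d^:P) * cross (Q`_i %/ d) (l %/ d).
  by rewrite -cross_mul !divpK ?dvdp_gcdl ?dvdp_gcdr.
have da : d.[a] != 0.
  apply: contraNneq la => da; rewrite -(divpK (dvdp_gcdr Q`_i l)) -/d.
  by rewrite hornerM da mulr0.
have c0 : cross (Q`_i %/ d) (l %/ d) != 0.
  by apply: contraNneq ci0 => c0; rewrite ciE c0 mulr0.
exists (Q`_i %/ d), (l %/ d); split=> //.
- exact: leq_trans (leq_divp _ _) (size_coef_Q i).
- by apply: leq_trans (leq_divp _ _) _; rewrite lE.
have [u uE] : exists u, cross (Q`_i %/ d) (l %/ d) = f * u.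
  apply/phiP/eqP; have /phiP/eqP := residue_coef_cross i (size f).
  rewrite -/Q -lE ciE !rmorphM !mulf_eq0 => /orP[|//].
  by rewrite -[phi _%:P]/(ex d) -[phi _^:P]/(ey d) (negPf (ex_neq0 da)) (negPf (ey_neq0 da)).
have /factor_theorem[v vE] : root u 'X.
  have /eqP := congr1 (horner^~ 'X) uE.
  rewrite /cross !(hornerD, hornerN, hornerM, hornerC).
  rewrite ![_^:P.['X]]comp_polyXr [l %/ d * _]mulrC subrr eq_sym mulf_eq0.
  by rewrite (negPf diag_f).
by exists v; rewrite uE vE /Q mulrA mulrC mulrA.
Qed.

(** Q and [cross b1 b2] have the same degree in each variable, so the cofactor u is a constant. *)
Lemma residue_decomposition : exists k (b1 b2 : {poly K}) (w : {poly {poly K}}),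
  [/\ (1 < k < n)%N, (size b1 <= k.+1)%N, (size b2 <= k.+1)%N
    & [/\ (size w + k <= n.+1)%N, (size (swapXY w) + k <= n.+1)%N
        & cross b1 b2 * w = cross p q]].
Proof.
have [b1 [b2 [sz1 sz2 b0 [u uE]]]] := cross_coef_reduced.
have u0 : u != 0 by apply: contraNneq b0 => u0; rewrite uE u0 mulr0.
have X0 : 'X%:P - 'X != 0 :> {poly {poly K}} by rewrite -opprB oppr_eq0 polyXsubC_eq0.
have g1 : (1 < size g)%N by apply: primx_nunit g_prim _.
have szb : (size (cross b1 b2) <= (size f).+1)%N by rewrite size_cross // geq_max sz1.
have [c c0 uc] : exists2 c, c != 0 & u = c%:P%:P.
  have szu : size u = 1%N.
    have := szb; rewrite uE size_mul // size_Q addSn /= -addn1 leq_add2l => u1.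
    by apply/eqP; rewrite eqn_leq u1 size_poly_gt0.
  have szsu : size (swapXY u) = 1%N.
    have := congr1 (fun v => size (swapXY v)) uE.
    rewrite swapXY_cross size_polyN rmorphM /= size_mul ?swapXY_eq0 // size_swapXY_Q.
    move=> E; move: szb; rewrite E addSn /= -addn1 leq_add2l => u1.
    by apply/eqP; rewrite eqn_leq u1 size_poly_gt0 swapXY_eq0.
  have /size_poly1P[d d0 ud] : size u == 1%N by rewrite szu.
  move: szsu; rewrite ud swapXY_polyC size_map_polyC => /eqP/size_poly1P[c c0 ->].
  by exists c.
have szh : size h = n.
  have szc : size (h * ('X%:P - 'X)) = n.+1.
    have n0 : cross p q != 0 by rewrite -hE mulf_neq0 // (primx_neq0 h_prim).
    by rewrite hE size_cross // size_p; apply/maxn_idPl; rewrite leqW.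
  move: szc; rewrite -opprB mulrN size_polyN size_Mmonic ?monicXsubC ?primx_neq0 //.
  by rewrite size_XsubC addn2 => -[].
have szfg : (size f + size g).-1 = n by rewrite -szh hfg size_mul ?primx_neq0.
have szsg : (size f + size (swapXY g)).-1 = n.
  rewrite -szh -(swapXY_cross_quotient hE) hfg rmorphM /= -size_swapXY_f.
  by rewrite size_mul ?swapXY_eq0 ?primx_neq0.
(* [size f] is the degree of Q in y. The sign arises because Q contains Y - x, whereas h is
   multiplied by x - Y. *)
exists (size f), b1, b2, ((- c^-1)%:P%:P * g).
have nc0 : - c^-1 != 0 by rewrite oppr_eq0 invr_eq0.
have fg1 := f_size_gt1.
have key (x y : nat) : (x + y).-1 = n -> (1 < x)%N -> (y + x <= n.+1)%N by clear; lia.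
split=> //; first by move: szfg g1 fg1; clear; lia.
split.
- rewrite mul_polyC size_scale ?polyC_eq0 //.
  exact: key szfg fg1.
- rewrite rmorphM /= swapXY_polyC map_polyC /= mul_polyC size_scale ?polyC_eq0 //.
  exact: key szsg fg1.
have cc : c%:P%:P * (- c^-1)%:P%:P = -1 :> {poly {poly K}}.
  by rewrite -!polyCM mulrN mulfV // !polyCN.
rewrite uE uc -mulrA [c%:P%:P * _]mulrA cc -hE hfg /Q mulN1r mulrN -mulNr.
by rewrite -[in LHS]mulNr opprB -mulrA mulrC.
Qed.

End ResidueField.

Lemma factor_decomposition : exists k (b1 b2 : {poly K}) (w : {poly {poly K}}),
  [/\ (1 < k < n)%N, (size b1 <= k.+1)%N, (size b2 <= k.+1)%N
    & [/\ (size w + k <= n.+1)%N, (size (swapXY w) + k <= n.+1)%N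
        & cross b1 b2 * w = cross p q]].
Proof.
have fnu : f \isn't a GRing.unit by case: f_irr.
have [M [phi phiP]] := prime_residue_field fnu
  (fun u v => @irreducible_primx_prime K f u v f_prim f_irr).
exact: residue_decomposition phiP.
Qed.

End FactorThroughDoublePoint.

(** * Decomposition of a rational function *)

Lemma eq_div_of_mul (F : fieldType) (x y z t : F) :
  y != 0 -> t != 0 -> x * t = z * y -> x / y = z / t.
Proof. by move=> y0 t0 xt; apply/eqP; rewrite eqr_div // xt. Qed.

Lemma mul_of_eq_div_div (F : fieldType) (x y z t r : F) :
  y != 0 -> t != 0 -> r != 0 -> x / y = (z / r) / (t / r) -> x * t = z * y.
Proof.
move=> y0 t0 r0; rewrite -mulf_div divff ?invr_eq0 // mulr1 => /eqP.
by rewrite eqr_div // => /eqP.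
Qed.

Section Evaluation.
Variable K : fieldType.
Local Notation E := {fraction {poly K}}.

Definition eval_morph (B : E) : {rmorphism {poly K} -> E} :=
  horner_eval B \o map_poly (@FracField.tofrac {poly K} \o polyC).

Lemma eval_morphC (B : E) c : eval_morph B c%:P = c%:P%:F.
Proof. by rewrite /= /horner_eval map_polyC hornerC. Qed.

Lemma eval_morphX (B : E) : eval_morph B 'X = B.
Proof. by rewrite /= /horner_eval map_polyX hornerX. Qed.

Lemma mul_rden_rnum (N D : {poly K}) : D != 0 ->
  N * rden (N%:F / D%:F) = rnum (N%:F / D%:F) * D.
Proof.
move=> D0; apply/eqP; rewrite -tofrac_eq !tofracM.
by rewrite -eqr_div ?tofrac_eq0 ?rden_neq0 // -rnum_rden.
Qed.

Lemma eval_neq0 (D : {poly K}) (B : E) : eval_morph B D != 0 -> D != 0.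
Proof. by apply: contraNneq => ->; rewrite rmorph0. Qed.

Lemma eval_rden_neq0 (N D : {poly K}) (B : E) :
  eval_morph B D != 0 -> eval_morph B (rden (N%:F / D%:F)) != 0.
Proof.
move=> D0; have ND := mul_rden_rnum N (eval_neq0 D0).
set A := _ / _ in ND *.
have copA : coprimep (rden A) (rnum A) by rewrite coprimep_sym coprime_rnum_rden.
have : rden A %| D by rewrite -(Gauss_dvdpr _ copA) -ND dvdp_mull.
by case/dvdpP => d DE; apply: contraNneq D0 => r0; rewrite DE rmorphM r0 mulr0.
Qed.

(** [rcomp] is defined through lowest terms; this permits any representative whose denominator does
    not vanish at B. *)
Lemma rcomp_frac (N D : {poly K}) (B : E) : eval_morph B D != 0 ->
  rcomp (N%:F / D%:F) B = eval_morph B N / eval_morph B D.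
Proof.
move=> D0; apply: (eq_div_of_mul (eval_rden_neq0 N D0) D0).
by rewrite -!(rmorphM (eval_morph B)) mul_rden_rnum // (eval_neq0 D0).
Qed.

Lemma eval_linear (b1 b2 l : {poly K}) : b2 != 0 -> (size l <= 2)%N ->
  eval_morph (b1%:F / b2%:F) l = (l`_1 *: b1 + l`_0 *: b2)%:F / b2%:F.
Proof.
move=> b20 sl; have lE : l = (l`_1)%:P * 'X + (l`_0)%:P.
  apply/polyP => i; rewrite coefD coefCM coefX coefC.
  case: i => [|[|i]] /=; rewrite ?mulr0 ?add0r ?mulr1 ?addr0 //.
  by rewrite nth_default // (leq_trans sl).
rewrite {1}lE rmorphD rmorphM !eval_morphC eval_morphX -!mul_polyC.
rewrite tofracD !tofracM [in RHS]mulrDl mulrA; congr (_ + _).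
by rewrite mulfK // tofrac_eq0.
Qed.
End Evaluation.

(** * From a divisor [cross b1 b2] of [cross p q] to a decomposition of p/q *)

Section CrossDecomposition.
Variables (K : numClosedFieldType) (p q b1 b2 : {poly K}) (w : {poly {poly K}}).
Variables (k n : nat).
Hypotheses (cop : coprimep p q) (q0 : q != 0).
Hypotheses (size_pq : maxn (size p) (size q) = n.+1) (k_gt1 : (1 < k)%N) (k_lt : (k < n)%N).
Hypotheses (size_b1 : (size b1 <= k.+1)%N) (size_b2 : (size b2 <= k.+1)%N).
Hypotheses (size_w : (size w + k <= n.+1)%N) (bw : cross b1 b2 * w = cross p q).

Let pq_prim : primx (cross p q).
Proof. by apply: primx_cross; rewrite // size_pq ltnS (leq_ltn_trans _ k_lt). Qed.

Let bw_prim : primx (cross b1 b2) /\ primx w.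
Proof. by apply: primxM; rewrite bw. Qed.

Let b_neq0 : cross b1 b2 != 0.
Proof. by apply: primx_neq0; case: bw_prim. Qed.

(** Degrees in y add up to n and w has degree at most n - k, so the bound k is attained. *)
Let size_b : maxn (size b1) (size b2) = k.+1.
Proof.
apply/eqP; rewrite eqn_leq geq_max size_b1 size_b2 /=.
have w0 : w != 0 by apply: primx_neq0; case: bw_prim.
have szE : (size (cross b1 b2) + size w).-1 = n.+1.
  by rewrite -size_mul // bw size_cross // (primx_neq0 pq_prim).
move: szE size_w; rewrite size_cross //.
have key (x y : nat) : (x + y).-1 = n.+1 -> (y + k <= n.+1)%N -> (k < x)%N.
  by clear; lia.
exact: key.
Qed.

Let coprime_b : coprimep b1 b2.
Proof.
apply: coprimep_no_root => z [/rootP z1 /rootP z2].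
have [/(_ z) + _] := bw_prim; rewrite specx_cross z1 z2 !scale0r subr0.
by rewrite eqxx.
Qed.

Let b2_neq0 : b2 != 0.
Proof.
apply/eqP => b20; move: coprime_b size_b; rewrite b20 coprimep0.
rewrite -size_poly_eq1 size_poly0 maxn0 => /eqP -> [] k0.
by move: k_gt1; rewrite -k0.
Qed.

Section Evaluations.
Variables (F : fieldType) (io ev : {rmorphism {poly K} -> F}).
Hypotheses (io_inj : injective io) (ioC : forall x, ev x%:P = io x%:P).
Hypothesis evX : io b2 * ev 'X = io b1.

Let c : {rmorphism K -> F} := io \o polyC.
(** The variable X of the coefficients stands for B: [GE] is b1(Y) - B b2(Y), whose roots form the
    fibre of B through x. *)
Let G : {poly {poly K}} := b1^:P - 'X%:P * b2^:P.
Let GE := map_poly ev G.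

Let ev_map (r : {poly K}) : map_poly ev r^:P = map_poly c r.
Proof. by rewrite -map_poly_comp; apply: eq_map_poly => x; exact: ioC. Qed.

Let io_b2 : io b2 != 0.
Proof. by rewrite -(rmorph0 io) (inj_eq io_inj). Qed.

Let io_cross_b : map_poly io (cross b1 b2) = - (io b2 *: GE).
Proof.
rewrite map_cross /GE /G rmorphB rmorphM /= map_polyC !ev_map /= mul_polyC.
by rewrite scalerBr scalerA evX opprB.
Qed.

Let size_GE : size GE = k.+1.
Proof.
rewrite -(size_scale _ io_b2) -size_polyN -io_cross_b.
by rewrite (size_map_inj_poly io_inj (rmorph0 io)) size_cross.
Qed.

Let size_G : size G = k.+1.
Proof.
apply/eqP; rewrite eqn_leq -{2}size_GE [(size GE <= _)%N]size_poly andbT.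
apply: leq_trans (size_polyD _ _) _; rewrite size_polyN geq_max size_map_polyC size_b1.
by rewrite mul_polyC (leq_trans (size_scale_leq _ _)) // size_map_polyC.
Qed.

Let lead_G : ev (lead_coef G) != 0.
Proof.
rewrite lead_coefE size_G -coef_map -size_GE -lead_coefE.
by rewrite lead_coef_eq0 -size_poly_eq0 size_GE.
Qed.

Let GE_dvd : GE %| io p *: map_poly c q - io q *: map_poly c p.
Proof.
rewrite -map_cross -bw rmorphM /= io_cross_b -scalerN -scalerAl.
by rewrite dvdpZr // mulNr dvdpNr dvdp_mulr.
Qed.

(** Pseudo-division takes place over K[X], before X is replaced by B, so that the coefficients of
    the remainders are polynomials in B. *)
Let rem (r : {poly K}) : {poly {poly K}} := r^:P %% G.
Let lc (r : {poly K}) : {poly K} := lead_coef G ^+ scalp r^:P G.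

Let ev_lc r : ev (lc r) != 0.
Proof. by rewrite rmorphXn expf_neq0. Qed.

Let size_rem r : (size (map_poly ev (rem r)) < size GE)%N.
Proof.
apply: leq_ltn_trans (size_poly _ _) _; rewrite size_GE -size_G ltn_modp.
by rewrite -size_poly_eq0 size_G.
Qed.

Let rem_mod r : GE %| ev (lc r) *: map_poly c r - map_poly ev (rem r).
Proof.
have := congr1 (map_poly ev) (Pdiv.Idomain.divp_eq r^:P G).
rewrite -mul_polyC rmorphM /= map_polyC ev_map /= mul_polyC => ->.
by rewrite rmorphD rmorphM /= addrK dvdp_mull.
Qed.

(** [GE] divides p(x) q(Y) - q(x) p(Y), hence also the same combination of remainders, whose degree
    is too small unless it is 0. *)
Let rem_prop : (io p * ev (lc p)) *: map_poly ev (rem q)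
  = (io q * ev (lc q)) *: map_poly ev (rem p).
Proof.
set T1 := _ *: _; set T2 := _ *: _; apply/eqP; rewrite -subr_eq0.
apply: contraT => T0; have : GE %| T1 - T2.
  pose U r := ev (lc r) *: map_poly c r - map_poly ev (rem r).
  have -> : T1 - T2 = (ev (lc p) * ev (lc q)) *: (io p *: map_poly c q - io q *: map_poly c p)
     - (io p * ev (lc p)) *: U q + (io q * ev (lc q)) *: U p.
    rewrite /T1 /T2 /U -!mul_polyC !polyCM; ring.
  have dvdZ x u : GE %| u -> GE %| x *: u by move=> ?; rewrite -mul_polyC dvdp_mull.
  by rewrite dvdp_add ?dvdp_sub ?dvdZ ?rem_mod.
move=> /(dvdp_leq T0); rewrite leqNgt; case/negP.
apply: leq_ltn_trans (size_polyD _ _) _; rewrite size_polyN gtn_max.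
by rewrite !(leq_ltn_trans (size_scale_leq _ _)).
Qed.

(** If it vanished, so would the remainder of p, and [GE] would divide the coprime p(Y) and q(Y). *)
Let rem_neq0 : map_poly ev (rem q) != 0.
Proof.
have dvd_c r : map_poly ev (rem r) = 0 -> GE %| map_poly c r.
  by move=> r0; have := rem_mod r; rewrite r0 subr0 dvdpZr.
apply/eqP => rq0; have /esym/eqP := rem_prop.
have io_q : io q != 0 by rewrite -(rmorph0 io) (inj_eq io_inj).
rewrite rq0 scaler0 scaler_eq0 mulf_eq0 (negPf io_q) (negPf (ev_lc q)) /=.
move=> /eqP rp0; have : GE %| gcdp (map_poly c p) (map_poly c q).
  by rewrite dvdp_gcd !dvd_c.
rewrite -gcdp_map => /dvdp_leq; rewrite map_poly_eq0 gcdp_eq0 (negPf q0) andbF.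
rewrite size_map_poly (eqP cop) size_GE => /(_ isT); rewrite ltnS leqn0.
by move=> /eqP k0; move: k_gt1; rewrite k0.
Qed.

(** Comparing one coefficient in [rem_prop] expresses p(x)/q(x) as N(B)/D(B). *)
Lemma cross_fraction :
  exists N D : {poly K}, ev D != 0 /\ io p * ev D = ev N * io q.
Proof.
pose i := (size (map_poly ev (rem q))).-1.
exists (lc q * (rem p)`_i), (lc p * (rem q)`_i); split.
  by rewrite rmorphM mulf_neq0 // -coef_map -lead_coefE lead_coef_eq0.
have := congr1 (fun u : {poly F} => u`_i) rem_prop; rewrite !coefZ !coef_map /= => E.
by rewrite !(rmorphM ev) mulrA E [RHS]mulrC mulrA.
Qed.
End Evaluations.

Let b2F_neq0 : b2%:F != 0 :> {fraction {poly K}}.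
Proof. by rewrite tofrac_eq0. Qed.

Lemma cross_decomposable : decomposable (p%:F / q%:F).
Proof.
pose io : {rmorphism {poly K} -> {fraction {poly K}}} := @FracField.tofrac {poly K}.
pose B : {fraction {poly K}} := b1%:F / b2%:F.
have io_inj : injective io by move=> u v /eqP; rewrite tofrac_eq => /eqP.
have [|N [D [D0 pqE]]] := @cross_fraction _ io (eval_morph B) io_inj (eval_morphC B).
  by rewrite eval_morphX mulrC divfK.
pose A : {fraction {poly K}} := N%:F / D%:F.
have qF : q%:F != 0 :> {fraction {poly K}} by rewrite tofrac_eq0.
have PE : p%:F / q%:F = rcomp A B 
  by rewrite (rcomp_frac N D0) (eq_div_of_mul qF D0 pqE).
have rdB : rdeg B = k by rewrite rdegE // size_b.
exists A, B; split; [ | by rewrite rdB | exact: PE].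
(* If deg A were at most 1, A o B would be a quotient of two linear combinations of b1 and b2, of
   degree at most k < n = deg P. *)
rewrite ltnNge; apply/negP; rewrite /rdeg => szA.
have [sn sd] : (size (rnum A) <= 2)%N /\ (size (rden A) <= 2)%N.
  by apply/andP; rewrite -geq_max; move: szA; case: (maxn _ _).
have rd0 := eval_rden_neq0 N D0.
set u := (rnum A)`_1 *: b1 + (rnum A)`_0 *: b2.
set v := (rden A)`_1 *: b1 + (rden A)`_0 *: b2.
have evv : eval_morph B (rden A) = v%:F / b2%:F by apply: eval_linear.
have evu : eval_morph B (rnum A) = u%:F / b2%:F by apply: eval_linear.
have vF : v%:F != 0 :> {fraction {poly K}}.
  by apply: contraNneq rd0 => v0; rewrite evv v0 mul0r.
have v0 : v != 0 by rewrite -tofrac_eq0.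
have uv : p * v = u * q.
  apply/eqP; rewrite -tofrac_eq !tofracM; apply/eqP.
  by apply: (mul_of_eq_div_div qF vF b2F_neq0); rewrite -evv -evu; exact: PE.
have size_lin x y : (size (x *: b1 + y *: b2)%R <= k.+1)%N.
  apply: leq_trans (size_polyD _ _) _; rewrite geq_max.
  by rewrite !(leq_trans (size_scale_leq _ _)).
have copq : coprimep q p by rewrite coprimep_sym.
have qv : (size q <= k.+1)%N.
  apply: leq_trans (size_lin _ _); apply: (dvdp_leq v0).
  by rewrite -(Gauss_dvdpr _ copq) uv dvdp_mull.
have pu : (size p <= k.+1)%N.
  have [->|p0] := eqVneq p 0; first by rewrite size_poly0.
  have u0 : u != 0.
    by apply: contraNneq p0 => u0; move/eqP: uv; rewrite u0 mul0r mulf_eq0 (negPf v0) orbF.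
  apply: leq_trans (size_lin _ _); apply: (dvdp_leq u0).
  by rewrite -(Gauss_dvdpl _ cop) -uv dvdp_mulr.
have : (n.+1 <= k.+1)%N by rewrite -size_pq geq_max pu.
by rewrite ltnS leqNgt k_lt.
Qed.
End CrossDecomposition.

(** * The involution z |-> c + 1 / (z - c) *)

Section Moebius.
Variables (K : numClosedFieldType) (c : K).
Implicit Types (p q r : {poly K}) (f g h : {poly {poly K}}) (x y z : K).

Lemma poly_ext_off p q : (forall z, z != c -> p.[z] = q.[z]) -> p = q.
Proof.
move=> pq; have X0 : 'X - c%:P != 0 :> {poly K} by rewrite polyXsubC_eq0.
apply: (mulIf X0); apply/eqP; rewrite -subr_eq0; apply: contraT.
move=> /closed_nonrootP[z]; rewrite /root !(hornerD, hornerN, hornerM, hornerX, hornerC).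
have [->|zc] := eqVneq z c; first by rewrite subrr !mulr0 subrr eqxx.
by rewrite pq // subrr eqxx.
Qed.

Lemma poly2_ext_off f g :
  (forall x y, x != c -> y != c -> f.[y%:P].[x] = g.[y%:P].[x]) -> f = g.
Proof.
move=> fg; apply/polyP => i; apply: poly_ext_off => x xc.
have /(congr1 (fun p : {poly K} => p`_i)) : specx x f = specx x g.
  by apply: poly_ext_off => y yc; rewrite -!horner2_specx fg.
by rewrite !coef_map.
Qed.

(** As a map of the projective line it exchanges c and infinity. *)
Definition moebius z : K := c + (z - c)^-1.

Lemma moebius_sub z : moebius z - c = (z - c)^-1.
Proof. by rewrite /moebius addrC addKr. Qed.

Lemma moebius_neq z : z != c -> moebius z != c.
Proof. by rewrite -!(subr_eq0 _ c) moebius_sub invr_eq0. Qed.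

Lemma moebiusK z : moebius (moebius z) = z.
Proof. by rewrite {1}/moebius moebius_sub invrK addrC subrK. Qed.

Definition moebius_monom n i : {poly K} :=
  (c *: ('X - c%:P) + 1) ^+ i * ('X - c%:P) ^+ (n - i).

(* (x - c)^n p(c + 1 / (x - c)), for p of degree at most n; similarly below   *)
(* (x - c)^m (y - c)^n f(c + 1 / (x - c), c + 1 / (y - c)).                   *)
Definition moebius_poly n p : {poly K} := \sum_(i < n.+1) p`_i *: moebius_monom n i.

Definition moebius_poly2 m n f : {poly {poly K}} :=
  \sum_(i < n.+1) (moebius_poly m f`_i)%:P * (moebius_monom n i)^:P.

Lemma horner_moebius_monom n i z : (i <= n)%N -> z != c ->
  (moebius_monom n i).[z] = (z - c) ^+ n * moebius z ^+ i.
Proof.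
move=> le_in zc; have zc0 : z - c != 0 by rewrite subr_eq0.
have E : c * (z - c) + 1 = (z - c) * moebius z.
  by rewrite /moebius [RHS]mulrDr mulfV // mulrC.
rewrite hornerM !horner_exp hornerD hornerZ hornerXsubC hornerC E exprMn.
by rewrite -{2}(subnK le_in) exprD; ring.
Qed.

Lemma horner_moebius n p z : (size p <= n.+1)%N -> z != c ->
  (moebius_poly n p).[z] = (z - c) ^+ n * p.[moebius z].
Proof.
move=> szp zc; rewrite (horner_coef_wide _ szp) mulr_sumr horner_sum.
apply: eq_bigr => i _; rewrite hornerZ horner_moebius_monom ?leq_ord //.
by rewrite mulrCA.
Qed.

Lemma horner_moebius_center n p : (moebius_poly n p).[c] = p`_n.
Proof.
rewrite horner_sum big_ord_recr /= big1 => [|i _].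
  rewrite add0r hornerZ hornerM !horner_exp hornerD hornerZ hornerXsubC hornerC.
  by rewrite subrr subnn mulr0 add0r expr1n expr0 !mulr1.
rewrite hornerZ hornerM [X in _ * (_ * X)]horner_exp hornerXsubC subrr expr0n.
by rewrite subn_eq0 leqNgt ltn_ord !mulr0.
Qed.

Lemma size_moebius_monom n i : (i <= n)%N -> (size (moebius_monom n i) <= n.+1)%N.
Proof.
move=> le_in; apply: leq_trans (size_polyMleq _ _) _.
have s1 : (size (c *: ('X - c%:P) + 1)%R <= 2)%N.
  apply: leq_trans (size_polyD _ _) _; rewrite size_poly1 geq_max andbT.
  by rewrite (leq_trans (size_scale_leq _ _)) // size_XsubC.
have := size_poly_exp_leq (c *: ('X - c%:P) + 1) i.
rewrite size_exp_XsubC => s2.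
have s3 : (size ((c *: ('X - c%:P) + 1) ^+ i)%R <= i.+1)%N.
  apply: leq_trans s2 _; rewrite ltnS -[X in (_ <= X)%N]mul1n leq_mul2r.
  by rewrite -subn1 leq_subLR s1 orbT.
rewrite addnS /=; apply: leq_trans (leq_add s3 (leqnn _)) _.
by rewrite addSn subnKC.
Qed.

Lemma size_moebius_poly n p : (size (moebius_poly n p) <= n.+1)%N.
Proof.
apply: leq_trans (size_sum _ _ _) _; apply/bigmax_leqP => i _.
by rewrite (leq_trans (size_scale_leq _ _)) // size_moebius_monom // leq_ord.
Qed.

Lemma moebius_polyK n p : (size p <= n.+1)%N -> moebius_poly n (moebius_poly n p) = p.
Proof.
move=> szp; apply: poly_ext_off => z zc.
rewrite horner_moebius ?size_moebius_poly // horner_moebius ?moebius_neq //.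
by rewrite moebiusK moebius_sub mulrA -exprMn mulfV ?subr_eq0 // expr1n mul1r.
Qed.

Lemma coef_moebius_poly n p : (size p <= n.+1)%N -> (moebius_poly n p)`_n = p.[c].
Proof. by move=> szp; rewrite -{2}(moebius_polyK szp) horner_moebius_center. Qed.

Lemma horner_moebius2 m n f x y :
  (size f <= n.+1)%N -> (size (swapXY f) <= m.+1)%N -> x != c -> y != c ->
  (moebius_poly2 m n f).[y%:P].[x] =
    (x - c) ^+ m * (y - c) ^+ n * f.[(moebius y)%:P].[moebius x].
Proof.
move=> szf szsf xc yc; rewrite !horner_sum [f.[_]](horner_coef_wide _ szf).
rewrite horner_sum mulr_sumr; apply: eq_bigr => i _.
rewrite !hornerM !hornerC [_^:P.[_]]horner_map hornerC.
rewrite horner_moebius_monom ?leq_ord // horner_moebius //; last first.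
  by rewrite -sizeYE in szsf; rewrite (leq_trans (max_size_coefXY _ _)).
by rewrite horner_exp hornerC; ring.
Qed.

Lemma size_moebius2 m n f : (size (moebius_poly2 m n f) <= n.+1)%N.
Proof.
apply: leq_trans (size_sum _ _ _) _; apply/bigmax_leqP => i _.
rewrite mul_polyC (leq_trans (size_scale_leq _ _)) // size_map_polyC.
by rewrite size_moebius_monom // leq_ord.
Qed.

Lemma moebius_cross n p q x y :
  (size p <= n.+1)%N -> (size q <= n.+1)%N -> x != c -> y != c ->
  (cross (moebius_poly n p) (moebius_poly n q)).[y%:P].[x] =
  (x - c) ^+ n * (y - c) ^+ n * (cross p q).[(moebius y)%:P].[moebius x].
Proof.
by move=> szp szq xc yc; rewrite !horner2_cross !horner_moebius //; ring.
Qed.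

Lemma moebius2_mul m1 n1 m2 n2 f g :
  (size f <= n1.+1)%N -> (size (swapXY f) <= m1.+1)%N ->
  (size g <= n2.+1)%N -> (size (swapXY g) <= m2.+1)%N ->
  (size (f * g)%R <= (n1 + n2).+1)%N -> (size (swapXY (f * g)%R) <= (m1 + m2).+1)%N ->
  moebius_poly2 (m1 + m2) (n1 + n2) (f * g) =
    moebius_poly2 m1 n1 f * moebius_poly2 m2 n2 g.
Proof.
move=> szf szsf szg szsg szfg szsfg; apply: poly2_ext_off => x y xc yc.
by rewrite !hornerM !horner_moebius2 // !hornerM !exprD; ring.
Qed.

(** If the transform is a constant e, transforming back gives f = e (x - c)^m (y - c)^n, and
    primitivity in both variables forces m = n = 0. *)
Lemma moebius2_nunit m n f : primx f -> primx (swapXY f) ->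
  (size f <= n.+1)%N -> (size (swapXY f) <= m.+1)%N ->
  f \isn't a GRing.unit -> moebius_poly2 m n f \isn't a GRing.unit.
Proof.
move=> pf psf szf szsf; apply: contra => fu.
have [e e0 fE] : exists2 e, e != 0 & moebius_poly2 m n f = e%:P%:P.
  move: fu; rewrite poly_unitE => /andP[/size_poly1P[d d0 ->]].
  rewrite coefC /= poly_unitE => /andP[/size_poly1P[e e0 ->] _].
  by exists e.
have fE2 : f = e%:P%:P * (('X - c%:P) ^+ m)%:P * (('X - c%:P) ^+ n)^:P.
  apply: poly2_ext_off => x y xc yc.
  have := horner_moebius2 szf szsf (moebius_neq xc) (moebius_neq yc).
  rewrite !moebiusK !moebius_sub fE !hornerC !hornerM !hornerC.
  rewrite [_^:P.[_]]horner_map hornerC !horner_exp !hornerXsubC => ->.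
  have xc0 : x - c != 0 by rewrite subr_eq0.
  have yc0 : y - c != 0 by rewrite subr_eq0.
  rewrite !exprVn; field.
  by rewrite !expf_neq0.
have m0 : m = 0%N.
  apply/eqP; rewrite -leqn0 leqNgt; apply/negP => m_gt0.
  have /negP := pf c; apply; rewrite fE2 !specxM [specx c (_ ^+ m)%:P]specxC.
  by rewrite horner_exp hornerXsubC subrr expr0n -leqn0 leqNgt m_gt0 polyC0 mulr0 mul0r.
have n0 : n = 0%N.
  apply/eqP; rewrite -leqn0 leqNgt; apply/negP => n_gt0.
  have /negP := psf c; apply; rewrite fE2 !rmorphM /= swapXY_map_polyC !specxM.
  rewrite [specx c (_ ^+ n)%:P]specxC.
  by rewrite horner_exp hornerXsubC subrr expr0n -leqn0 leqNgt n_gt0 polyC0 mulr0.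
rewrite fE2 m0 n0 !expr0 ?polyC1 ?rmorph1 !mulr1 poly_unitE size_polyC polyC_eq0 e0 coefC /=.
by rewrite poly_unitE size_polyC e0 coefC unitfE /= e0.
Qed.

(** The sign comes from [moebius c x - moebius c y] = -(x - y) / ((x - c) (y - c)). *)
Lemma moebius_cross_quotient n h p q :
  (size p <= n.+2)%N -> (size q <= n.+2)%N ->
  (size h <= n.+1)%N -> (size (swapXY h) <= n.+1)%N ->
  h * ('X%:P - 'X) = cross p q ->
  - moebius_poly2 n n h * ('X%:P - 'X) =
    cross (moebius_poly n.+1 p) (moebius_poly n.+1 q).
Proof.
move=> szp szq szh szsh hE; apply: poly2_ext_off => x y xc yc.
rewrite moebius_cross // -hE !(hornerM, hornerN, hornerD, hornerC, hornerX).
rewrite horner_moebius2 // /moebius !exprS.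
have xc0 : x - c != 0 by rewrite subr_eq0.
have yc0 : y - c != 0 by rewrite subr_eq0.
by field; rewrite xc0 yc0.
Qed.

Lemma moebius_cross_decomposition n k p q (b1 b2 : {poly K}) (w : {poly {poly K}}) :
  (size p <= n.+1)%N -> (size q <= n.+1)%N ->
  (size b1 <= k.+1)%N -> (size b2 <= k.+1)%N -> (k <= n)%N ->
  (size w <= (n - k).+1)%N -> (size (swapXY w) <= (n - k).+1)%N ->
  cross b1 b2 * w = cross (moebius_poly n p) (moebius_poly n q) ->
  cross (moebius_poly k b1) (moebius_poly k b2) * moebius_poly2 (n - k) (n - k) w
    = cross p q.
Proof.
move=> szp szq sz1 sz2 kn szw szsw bw; apply: poly2_ext_off => x y xc yc.
rewrite -(moebius_polyK szp) -(moebius_polyK szq).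
rewrite moebius_cross ?size_moebius_poly // -bw hornerM hornerM moebius_cross //.
rewrite horner_moebius2 // !hornerM -{3 4}(subnKC kn) !exprD; ring.
Qed.

(** A common root at c would mean that both coefficients of degree n vanish, that is, a common root
    at infinity. *)
Lemma moebius_coprime n p q : coprimep p q -> (maxn (size p) (size q) = n.+1)%N ->
  coprimep (moebius_poly n p) (moebius_poly n q).
Proof.
move=> cop sz; have /andP[szp szq] : (size p <= n.+1)%N && (size q <= n.+1)%N.
  by rewrite -geq_max sz.
rewrite /coprimep; apply: contraT => /closed_rootP[z]; rewrite root_gcd /root.
have [->|zc] := eqVneq z c.
  rewrite !horner_moebius_center => /andP[/eqP pn /eqP qn].
  have le_n r : (size r <= n.+1)%N -> r`_n = 0 -> (size r <= n)%N.
    move=> szr rn; apply/leq_sizeP => j; rewrite leq_eqVlt => /predU1P[<- //|nj].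
    by rewrite nth_default // (leq_trans szr).
  by have : (n.+1 <= n)%N; [rewrite -sz geq_max !le_n | rewrite ltnn].
rewrite !horner_moebius // !mulf_eq0 !expf_eq0 subr_eq0 (negPf zc) !andbF /=.
move=> /andP[p0 q0]; have := coprimep_root cop p0.
by rewrite q0.
Qed.

End Moebius.

(** * Reduction to a double point at finite distance *)

Section ReducibleCross.
Variable K : numClosedFieldType.
Implicit Types (p q t : {poly K}) (f g h : {poly {poly K}}).

(** As h(a, a) = q(a) t(a) = 0, one factor vanishes at (a, a); its irreducible factor through that
    point feeds [factor_decomposition]. *)
Lemma monic_at_infinity_decomposition p q t n (a : K) h f g :
  coprimep p q -> size p = n.+1 -> (size q <= n)%N ->
  p = ('X - a%:P) * t -> separable_poly t -> root t a ->
  h * ('X%:P - 'X) = cross p q -> h = f * g ->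
  f \isn't a GRing.unit -> g \isn't a GRing.unit ->
  exists k (b1 b2 : {poly K}) (w : {poly {poly K}}),
  [/\ (1 < k < n)%N, (size b1 <= k.+1)%N, (size b2 <= k.+1)%N
    & [/\ (size w + k <= n.+1)%N, (size (swapXY w) + k <= n.+1)%N
        & cross b1 b2 * w = cross p q]].
Proof.
move=> cop szp szq pE t_sep ta hE; move: f g.
have pnc : (1 < maxn (size p) (size q))%N.
  have p0 : p != 0 by rewrite -size_poly_gt0 szp.
  by rewrite leq_max (@root_size_gt1 _ a) // /root pE hornerM hornerXsubC subrr mul0r.
have ph : primx h.
  have : primx (h * ('X%:P - 'X)) by rewrite hE; apply: primx_cross.
  by case/primxM.
have haa : h.[a%:P].[a] = 0.
  by rewrite horner2_specx (specx_cross_quotient hE pE) hornerZ (rootP ta) mulr0.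
have wl f g : f.[a%:P].[a] = 0 -> h = f * g ->
  f \isn't a GRing.unit -> g \isn't a GRing.unit ->
  exists k (b1 b2 : {poly K}) (w : {poly {poly K}}),
  [/\ (1 < k < n)%N, (size b1 <= k.+1)%N, (size b2 <= k.+1)%N
    & [/\ (size w + k <= n.+1)%N, (size (swapXY w) + k <= n.+1)%N
        & cross b1 b2 * w = cross p q]].
  move=> faa hfg fnu gnu; have [pf _] : primx f /\ primx g by apply: primxM; rewrite -hfg.
  have [f1 [v [fE f1_irr f1aa]]] := irreducible_factor_at pf faa.
  have hE' : h = f1 * (v * g) by rewrite mulrA -fE.
  apply: (factor_decomposition cop szp szq pE t_sep hE hE' f1_irr f1aa).
  by rewrite unitrM (negPf gnu) andbF.
move=> f g hfg fnu gnu.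
have : f.[a%:P].[a] * g.[a%:P].[a] == 0 by rewrite -!hornerM -hfg haa.
rewrite mulf_eq0 => /orP[/eqP faa|/eqP gaa]; first exact: wl faa hfg fnu gnu.
by apply: (wl g f gaa _ gnu fnu); rewrite mulrC.
Qed.

(** The transforms of p and q have coefficients p(c) and q(c) = 0 in degree n, so the first has
    degree n and the second a smaller one. The decomposition found there is transformed back. *)
Lemma reducible_cross_decomposition p q t n (a c : K) h f g :
  coprimep p q -> maxn (size p) (size q) = n.+1 -> p.[c] != 0 -> q.[c] = 0 ->
  moebius_poly c n p = ('X - a%:P) * t -> separable_poly t -> root t a ->
  h * ('X%:P - 'X) = cross p q -> h = f * g ->
  f \isn't a GRing.unit -> g \isn't a GRing.unit ->
  exists k (b1 b2 : {poly K}) (w : {poly {poly K}}),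
  [/\ (1 < k < n)%N, (size b1 <= k.+1)%N, (size b2 <= k.+1)%N,
      (size w + k <= n.+1)%N & cross b1 b2 * w = cross p q].
Proof.
move=> cop sz pc qc pE t_sep ta hE hfg fnu gnu.
have /andP[szp szq] : (size p <= n.+1)%N && (size q <= n.+1)%N by rewrite -geq_max sz.
have cop' := moebius_coprime c cop sz.
have szp' : size (moebius_poly c n p) = n.+1.
  apply/eqP; rewrite eqn_leq size_moebius_poly ltnNge; apply/negP.
  by move=> /leq_sizeP/(_ n (leqnn _))/eqP; rewrite coef_moebius_poly // (negPf pc).
have szq' : (size (moebius_poly c n q) <= n)%N.
  apply/leq_sizeP => j; rewrite leq_eqVlt => /predU1P[<-|nj].
    by rewrite coef_moebius_poly.
  by rewrite nth_default // (leq_trans (size_moebius_poly _ _ _)).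
have n_gt0 : (0 < n)%N.
  have p0 : moebius_poly c n p != 0 by rewrite -size_poly_gt0 szp'.
  by rewrite -ltnS -szp' (@root_size_gt1 _ a) // /root pE hornerM hornerXsubC subrr mul0r.
have pPhi : primx (cross p q) by apply: primx_cross; rewrite // sz ltnS.
have ph : primx h.
  by move: pPhi; rewrite -hE => /primxM[].
have swh := swapXY_cross_quotient hE.
have psh : primx (swapXY h) by rewrite swh.
have [pf pg] : primx f /\ primx g by apply: primxM; rewrite -hfg.
have [psf psg] : primx (swapXY f) /\ primx (swapXY g).
  by apply: primxM; rewrite -rmorphM -hfg.
have szh : size h = n.
  have : size (h * ('X%:P - 'X)) = n.+1 by rewrite hE size_cross ?primx_neq0.
  rewrite -opprB mulrN size_polyN size_Mmonic ?monicXsubC ?primx_neq0 //.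
  by rewrite size_XsubC addn2 => -[].
have [f0 g0] := (primx_neq0 pf, primx_neq0 pg).
have [sf0 sg0] := (primx_neq0 psf, primx_neq0 psg).
pose nf := (size f).-1; pose ng := (size g).-1.
pose mf := (size (swapXY f)).-1; pose mg := (size (swapXY g)).-1.
have fS : size f = nf.+1 by rewrite polySpred.
have gS : size g = ng.+1 by rewrite polySpred.
have sfS : size (swapXY f) = mf.+1 by rewrite polySpred.
have sgS : size (swapXY g) = mg.+1 by rewrite polySpred.
have nE : n = (nf + ng).+1 by rewrite -szh hfg size_mul // fS gS addnS.
have mE : n = (mf + mg).+1.
  by rewrite -szh -swh hfg rmorphM size_mul // sfS sgS addnS.
have h2E : - moebius_poly2 c n.-1 n.-1 h =
    (- moebius_poly2 c mf nf f) * moebius_poly2 c mg ng g.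
  rewrite mulNr -moebius2_mul ?fS ?gS ?sfS ?sgS -?hfg ?swh ?szh -?nE -?mE //.
  by rewrite {1}mE nE.
have nS : n = n.-1.+1 by rewrite prednK.
have h2cross : - moebius_poly2 c n.-1 n.-1 h * ('X%:P - 'X) =
    cross (moebius_poly c n p) (moebius_poly c n q).
  have := @moebius_cross_quotient _ c n.-1 h p q.
  by rewrite -nS swh szh; apply.
have fnu2 : - moebius_poly2 c mf nf f \isn't a GRing.unit.
  by rewrite unitrN moebius2_nunit ?fS ?sfS.
have gnu2 : moebius_poly2 c mg ng g \isn't a GRing.unit.
  by rewrite moebius2_nunit ?gS ?sgS.
have [k [b1 [b2 [w [/andP[k1 kn] sz1 sz2 [szw szsw bw]]]]]] :=
  monic_at_infinity_decomposition cop' szp' szq' pE t_sep ta h2cross h2E fnu2 gnu2.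
have le_kn := ltnW kn.
exists k, (moebius_poly c k b1), (moebius_poly c k b2).
exists (moebius_poly2 c (n - k) (n - k) w).
have wn s : (s + k <= n.+1)%N -> (s <= (n - k).+1)%N.
  by rewrite -subSn // leq_subRL ?(leqW le_kn) // addnC.
split; [by rewrite k1 | exact: size_moebius_poly | exact: size_moebius_poly | | ].
  by rewrite addnC -leq_subRL ?(leqW le_kn) // subSn // size_moebius2.
by apply: moebius_cross_decomposition; rewrite ?wn.
Qed.
End ReducibleCross.

(** * Simple critical values *)

Lemma card_eq_uniq_seq (T : choiceType) (A : set T) (n : nat) :
  (A #= `I_n)%classic%card ->
  exists s : seq T, [/\ uniq s, size s = n & forall x, x \in s <-> A x].
Proof.
move=> An; have finA : finite_set A by exists n.
exists (fset_set A); split; first exact: fset_uniq.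
  by have := card_fset_set An.
by move=> x; rewrite in_fset_set // in_setE.
Qed.

Section SimpleCriticalValue.
Variable K : numClosedFieldType.
Implicit Types (p q N M : {poly K}) (s : option K).

(* The zeros of N seen as a form of degree n, possibly at infinity.           *)
Definition proj_root n N (z : option K) : bool :=
  if z is Some a then root N a else N`_n == 0.

Lemma cross_addl_scale x N M : cross N (M + x *: N) = cross N M.
Proof.
rewrite /cross -mul_polyC polyCD polyCM rmorphD rmorphM /= map_polyC /=; ring.
Qed.

Lemma cross_oppr N M : cross M (- N) = cross N M.
Proof. by rewrite /cross polyCN rmorphN /=; ring. Qed.

Lemma cross_addl x N M : cross (N + x *: M) M = cross N M.
Proof. by rewrite crossN cross_addl_scale -crossN. Qed.

(** N is p - s q, or q when s is infinity; M completes it to a change of basis of determinant 1,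
    which preserves [cross]. *)
Lemma rmap_pencil (P : {fraction {poly K}}) n s :
  maxn (size (rnum P)) (size (rden P)) = n.+1 -> (0 < n)%N ->
  exists N M, cross N M = cross (rnum P) (rden P) /\
    forall z, rmap P z = s <-> proj_root n N z.
Proof.
move=> sz n_gt0; have q0 := rden_neq0 P; have cop := coprime_rnum_rden P.
rewrite /rmap; move: (rnum P) (rden P) sz q0 cop => p q sz q0 cop.
have /andP[szp szq] : (size p <= n.+1)%N && (size q <= n.+1)%N by rewrite -geq_max sz.
case: s => [s|]; last first.
  exists q, (- p); split; first exact: cross_oppr.
  move=> [a|] /=; first by rewrite /root; case: ifP.
  have sz_coef (r : {poly K}) : (size r <= n.+1)%N -> (r`_n == 0) = (size r <= n)%N.
    move=> szr; apply/eqP/idP => [rn|szn]; last by rewrite nth_default.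
    apply/leq_sizeP => j; rewrite leq_eqVlt => /predU1P[<- //|nj].
    by rewrite nth_default // (leq_trans szr).
  rewrite sz_coef //; move: sz szp szq; case: ltnP => [qp|pq].
    by move=> pn _ _; rewrite -ltnS -pn qp.
  by move=> -> _ _; rewrite ltnn.
exists (p + (- s) *: q), q; split; first exact: cross_addl.
move=> [a|] /=.
  rewrite /root hornerD hornerZ mulNr subr_eq0.
  have [qa0|qa0] := eqVneq q.[a] 0.
    have : p.[a] != 0.
      by apply: coprimep_root (_ : coprimep q p) _; rewrite ?/root ?qa0 // coprimep_sym.
    by rewrite qa0 mulr0 => /negPf ->.
  split=> [[<-]|/eqP ->]; first by rewrite divfK.
  by rewrite mulfK.
rewrite coefD coefZ mulNr subr_eq0; case: ltnP => [qp|pq].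
  split=> //; move: sz; rewrite (maxn_idPl (ltnW qp)) => pn.
  have szqn : (size q <= n)%N by rewrite -ltnS -pn.
  rewrite [q`_n]nth_default // mulr0.
  have : lead_coef p != 0 by rewrite lead_coef_eq0 -size_poly_gt0 pn.
  by rewrite lead_coefE pn /= => /negPf ->.
move: sz; rewrite (maxn_idPr pq) lead_coefE => szqn; rewrite szqn /=.
have qn0 : q`_n != 0 by move: q0; rewrite -lead_coef_eq0 lead_coefE szqn.
split=> [[<-]|/eqP ->]; first by rewrite divfK.
by rewrite mulfK.
Qed.

(** Since N(c) is nonzero, the n - 1 projective zeros of N become n - 1 distinct finite roots of a
    polynomial of degree n, infinity going to c. *)
Lemma moebius_simple_roots n N (c : K) (s : seq (option K)) :
  (size N <= n.+1)%N -> N.[c] != 0 -> uniq s -> (size s).+1 = n ->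
  (forall z, z \in s <-> proj_root n N z) ->
  exists a t,
  [/\ (1 < n)%N, moebius_poly c n N = ('X - a%:P) * t, separable_poly t & root t a].
Proof.
move=> szN Nc us sz sP.
pose m (z : option K) := if z is Some x then moebius c x else c.
pose L := map m s; set pt := moebius_poly c n N.
have szp : size pt = n.+1.
  apply/eqP; rewrite eqn_leq size_moebius_poly ltnNge; apply/negP.
  by move=> /leq_sizeP/(_ n (leqnn _))/eqP; rewrite coef_moebius_poly // (negPf Nc).
have p0 : pt != 0 by rewrite -size_poly_gt0 szp.
have s_neq x : Some x \in s -> x != c.
  by move/sP => /= Nx; apply: contraNneq Nc => <-.
have uL : uniq L.
  rewrite map_inj_in_uniq // => -[x|] [y|] //= xs ys.
  - by move=> /(congr1 (moebius c)); rewrite !moebiusK => ->.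
  - by move=> /eqP; rewrite (negPf (moebius_neq (s_neq _ xs))).
  - by move=> /esym/eqP; rewrite (negPf (moebius_neq (s_neq _ ys))).
have rootL z : root pt z = (z \in L).
  have [->|zc] := eqVneq z c.
    rewrite /root horner_moebius_center; apply/idP/mapP.
      by move=> /(sP None).2 sN; exists None.
    move=> [[x|] xs] /= cE; last exact: (sP None).1.
    by move: (moebius_neq (s_neq _ xs)); rewrite -cE eqxx.
  rewrite /root horner_moebius // mulf_eq0 expf_eq0 subr_eq0 (negPf zc) andbF /=.
  apply/idP/mapP.
    move=> /(sP (Some _)).2 sz'; exists (Some (moebius c z)) => //=.
    by rewrite moebiusK.
  move=> [[x|] xs] /= zE; last by rewrite zE eqxx in zc.
  by rewrite zE moebiusK; apply: (sP (Some x)).1.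
pose t0 := \prod_(z <- L) ('X - z%:P).
have /dvdpP[u pE] : t0 %| pt.
  apply: uniq_roots_dvdp; last by rewrite uniq_rootsE.
  by apply/allP => z; rewrite -rootL.
have u0 : u != 0 by apply: contraNneq p0 => u0; rewrite pE u0 mul0r.
have szu : size u = 2%N.
  move: szp; rewrite pE size_Mmonic ?monic_prod_XsubC // size_prod_XsubC.
  rewrite size_map sz addnC /= => E; apply/(@addIn n); rewrite addnC.
  by rewrite add2n -E prednK // addn_gt0 size_poly_gt0 u0 orbT.
have [a ua] : exists a, root u a by apply/closed_rootP; rewrite szu.
have [u' uE] := factor_theorem _ _ ua.
have u'0 : u' != 0 by apply: contraNneq u0 => u'0; rewrite uE u'0 mul0r.
have /size_poly1P[e e0 u'E] : size u' == 1%N.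
  move: szu; rewrite uE size_Mmonic ?monicXsubC // size_XsubC addn2 /=.
  by move=> [->].
(* The root of the remaining linear factor is again one of these roots, hence the double one. *)
have aL : a \in L by rewrite -rootL /root pE hornerM (rootP ua) mul0r.
exists a, (e *: t0); split.
- by rewrite -sz ltnS -(size_map m) lt0n size_eq0; apply: contraTneq aL; rewrite -/L => ->.
- by rewrite pE uE u'E -mul_polyC mulrA [_ * e%:P]mulrC.
- by rewrite (eqp_separable (eqp_scale _ e0)) separable_prod_XsubC.
- by rewrite rootZ // root_prod_XsubC.
Qed.

Lemma cross_scale2 e p q : cross (e *: p) (e *: q) = (e ^+ 2)%:P%:P * cross p q.
Proof.
rewrite /cross -!mul_polyC !polyCM !rmorphM /= !map_polyC /=; ring.
Qed.

End SimpleCriticalValue.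

Theorem hpoly_irreducible (K : numClosedFieldType) (P : {fraction {poly K}})
  (P1 P2 : {poly K})
  (P2_neq0 : P2 != 0)
  (P1P2_no_common_root : forall z, ~ (root P1 z /\ root P2 z))
  (PE : P = P1%:F / P2%:F)
  (P_indec : indecomposable P)
  (P_simple : exists s, simple_critical_value P s) :
  irreducible_elt (hpoly P1 P2).
Proof.
have cop12 := coprimep_no_root P1P2_no_common_root.
have [e e0 [pE qE]] := rnum_rden_uniq P2_neq0 cop12; rewrite -PE in pE qE.
have [s [m mE Pm]] := P_simple.
have [r [ur szr rP]] := card_eq_uniq_seq Pm.
have := mE; rewrite /rdeg; set p := rnum P in pE *; set q := rden P in qE *.
set d := maxn _ _ => dE.
have sz : d = m.+2 by move: dE; case: (d) => [//|d'] /= <-.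
have cop := coprime_rnum_rden P; rewrite -/p -/q in cop.
have [N [M [NM rootN]]] := rmap_pencil s sz isT.
rewrite -/p -/q in NM.
have prim : primx (cross p q) by apply: primx_cross; rewrite // -/d sz.
have copq : coprimep N M.
  apply: coprimep_no_root => z [/rootP Nz /rootP Mz].
  by have := prim z; rewrite -NM specx_cross Nz Mz !scale0r subrr eqxx.
have NM0 : cross N M != 0 by rewrite NM primx_neq0.
have N0 : N != 0.
  by apply: contraNneq NM0 => ->; rewrite /cross polyC0 rmorph0 mul0r mulr0 subrr.
have [c Nc] := closed_nonrootP _ N0.
(* Subtracting a multiple of N makes the second polynomial vanish at c without changing [cross]. *)
pose M' := M + (- (M.[c] / N.[c])) *: N.
have M'c : M'.[c] = 0 by rewrite hornerD hornerZ mulNr divfK // subrr.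
have NM' : cross N M' = cross p q by rewrite cross_addl_scale.
have szNM : maxn (size N) (size M') = m.+2.
  by rewrite -size_cross NM' ?size_cross // primx_neq0.
have copN : coprimep N M'.
  apply: coprimep_no_root => z [/rootP Nz /rootP Mz].
  by have := prim z; rewrite -NM' specx_cross Nz Mz !scale0r subrr eqxx.
have szN : (size N <= m.+2)%N by rewrite -szNM leq_maxl.
have rN z : z \in r <-> proj_root m.+1 N z.
  by rewrite -rootN; exact: rP.
have [a [t [m1 NE t_sep ta]]] :=
  moebius_simple_roots szN Nc ur (congr1 succn szr) rN.
set h := hpoly P1 P2; have hE : h * ('X%:P - 'X) = cross P1 P2 by exact: hpolyE.
have e2 : e ^+ 2 != 0 by rewrite expf_neq0.
(* Lowest terms are unique up to the scalar e, which enters [cross] squared. *)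
have heE : (e ^+ 2)%:P%:P * h * ('X%:P - 'X) = cross N M'.
  by rewrite -mulrA hE NM' pE qE cross_scale2.
have h0 : h != 0.
  apply: contraNneq (primx_neq0 prim) => h0.
  by rewrite -NM' -heE h0 mulr0 mul0r.
split=> // [|f g hfg].
  have szh : size h = m.+1.
    have : size ((e ^+ 2)%:P%:P * h * ('X%:P - 'X)) = m.+2.
      by rewrite heE size_cross ?szNM // NM' primx_neq0.
    rewrite -mulrA mul_polyC size_scale ?polyC_eq0 // -opprB mulrN size_polyN.
    by rewrite size_Mmonic ?monicXsubC // size_XsubC addn2 => -[].
  by rewrite poly_unitE szh; case: (m) m1.
have [fu|fnu] := boolP (f \is a GRing.unit); first by left.
right; apply/negPn/negP => gnu; apply: P_indec.
have ce_unit : (e ^+ 2)%:P%:P \is a @GRing.unit {poly {poly K}}.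
  rewrite poly_unitE size_polyC polyC_eq0 e2 coefC /=.
  by rewrite poly_unitE size_polyC e2 coefC unitfE.
have fnu' : (e ^+ 2)%:P%:P * f \isn't a GRing.unit by rewrite unitrM ce_unit.
have hfg' : (e ^+ 2)%:P%:P * h = (e ^+ 2)%:P%:P * f * g by rewrite -mulrA -hfg.
have [k [b1 [b2 [w [/andP[k1 km] sz1 sz2 szw bw]]]]] :=
  reducible_cross_decomposition copN szNM Nc M'c NE t_sep ta heE hfg' fnu' gnu.
rewrite [P]rnum_rden.
by apply: (cross_decomposable cop (rden_neq0 P) sz k1 km sz1 sz2 szw); rewrite bw.
Qed.

Theorem proposition3p4 (R : realType) (P : {fraction {poly complex R}})
  (P1 P2 : {poly complex R})
  (P2_neq0 : P2 != 0)
  (P1P2_no_common_root : forall z, ~ (root P1 z /\ root P2 z))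
  (PE : P = P1%:F / P2%:F)
  (P_indec : indecomposable P)
  (P_simple : exists s, simple_critical_value P s) :
  irreducible_elt (hpoly P1 P2).
Proof. exact: hpoly_irreducible PE P_indec P_simple. Qed.
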